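(* Let $k$ be a field and let $Q$ be a finite quiver. Then there is an admissible ideal $I$ of $kQ$ such that $\operatorname{gldim}(kQ/I)=2$ if and only if $Q$ has no loops and $(kQ^+)^2\neq 0$.
   Context: A finite quiver $Q=(Q_0,Q_1,s,t)$ has finite vertex set $Q_0$, finite arrow set $Q_1$ and maps $s,t\colon Q_1\to Q_0$ giving start and terminal point of each arrow; a loop is an arrow $a$ with $s(a)=t(a)$. The path algebra $kQ$ has the oriented paths (including a path of length zero for each vertex) as $k$-basis, with product given by concatenation when possible and $0$ otherwise. $kQ^+$ is the ideal of $kQ$ generated by all arrows. A two-sided ideal $I$ of $kQ$ is admissible if $(kQ^+)^N\subseteq I\subseteq (kQ^+)^2$ for some integer $N>0$. $\operatorname{gldim}(kQ/I)$ is the supremum of the projective dimensions of all finite-dimensional left $kQ/I$-modules. *)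

(* Defs.v *)
From HB Require Import structures.
From mathcomp Require Import all_boot all_algebra.
From mathcomp Require Import finmap monalg.
From mathcomp Require Import boolp classical_sets.

Set Implicit Arguments.
Unset Strict Implicit.
Unset Printing Implicit Defensive.

Import GRing.Theory.
Local Open Scope classical_set_scope.
Local Open Scope ring_scope.
Local Open Scope quotient_scope.

Section Ideals.
Variable R : pzRingType.

Definition is_ideal (I : set R) : Prop :=
  [/\ I 0, (forall x y, I x -> I y -> I (x + y)),
      (forall a x, I x -> I (a * x)) & (forall a x, I x -> I (x * a))].

Record ideal := Ideal { ideal_set :> set R; idealP : is_ideal ideal_set }.

Definition gen_ideal (S : set R) : set R :=
  [set x | forall J : ideal, S `<=` J -> ideal_set J x].

Definition ideal_mul (I J : set R) : set R :=
  [set x | exists s : seq (R * R),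
     (forall p, p \in s -> I p.1 /\ J p.2) /\ x = \sum_(p <- s) p.1 * p.2].

Fixpoint ideal_exp (I : set R) (n : nat) : set R :=
  if n is m.+1 then ideal_mul I (ideal_exp I m) else setT.

End Ideals.

Section Quotient.
Variables (A : pzRingType) (I : ideal A).

Definition ideal_pred : {pred A} := fun x => `[< ideal_set I x >].

Lemma ideal_pred_closed : zmod_closed ideal_pred.
Proof.
have [I0 ID IMl IMr] := idealP I; split; first exact/asboolP.
move=> x y /asboolP Ix /asboolP Iy; apply/asboolP; apply: ID => //.
by rewrite -mulN1r; exact: IMl.
Qed.

HB.instance Definition _ := GRing.isZmodClosed.Build A ideal_pred
  ideal_pred_closed.

Definition quot_ring := Quotient.quot ideal_pred.

HB.instance Definition _ := GRing.Zmodule.on quot_ring.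
HB.instance Definition _ := EqQuotient.on quot_ring.
HB.instance Definition _ := ZmodQuotient.on quot_ring.

Lemma quot_eqP (x y : A) :
  \pi_quot_ring x = \pi_quot_ring y <-> ideal_set I (x - y).
Proof.
split=> [/eqP|Ixy]; last apply/eqP.
  by rewrite -Quotient.idealrBE => /asboolP.
by rewrite -Quotient.idealrBE; apply/asboolP.
Qed.

Definition quot_one : quot_ring := \pi_quot_ring 1.
Definition quot_mul (x y : quot_ring) : quot_ring :=
  \pi_quot_ring (repr x * repr y).

Lemma quot_repr (x : A) : ideal_set I (repr (\pi_quot_ring x) - x).
Proof. by apply/quot_eqP; rewrite reprK. Qed.

Lemma quot_mulE x y :
  quot_mul (\pi_quot_ring x) (\pi_quot_ring y) = \pi_quot_ring (x * y).
Proof.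
have [I0 ID IMl IMr] := idealP I; apply/quot_eqP.
set x' := repr _; set y' := repr _.
have -> : x' * y' - x * y = (x' - x) * y' + x * (y' - y).
  by rewrite mulrBl mulrBr addrA addrNK.
by apply: ID; [apply: IMr | apply: IMl]; exact: quot_repr.
Qed.

Lemma quot_addE (x y : A) :
  \pi_quot_ring x + \pi_quot_ring y = \pi_quot_ring (x + y).
Proof. by rewrite -[LHS]Quotient.pi_add. Qed.

Lemma quot_ind (P : quot_ring -> Prop) :
  (forall x : A, P (\pi_quot_ring x)) -> forall x, P x.
Proof. by move=> h x; rewrite -[x]reprK. Qed.

Lemma quot_mulA : associative quot_mul.
Proof.
by elim/quot_ind=> x; elim/quot_ind=> y; elim/quot_ind=> z;
  rewrite !quot_mulE mulrA.
Qed.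

Lemma quot_mul1q : left_id quot_one quot_mul.
Proof. by elim/quot_ind=> x; rewrite quot_mulE mul1r. Qed.

Lemma quot_mulq1 : right_id quot_one quot_mul.
Proof. by elim/quot_ind=> x; rewrite quot_mulE mulr1. Qed.

Lemma quot_mulDl : left_distributive quot_mul +%R.
Proof.
by elim/quot_ind=> x; elim/quot_ind=> y; elim/quot_ind=> z;
  rewrite quot_addE !quot_mulE mulrDl quot_addE.
Qed.

Lemma quot_mulDr : right_distributive quot_mul +%R.
Proof.
by elim/quot_ind=> x; elim/quot_ind=> y; elim/quot_ind=> z;
  rewrite quot_addE !quot_mulE mulrDr quot_addE.
Qed.

HB.instance Definition _ := GRing.Zmodule_isPzRing.Build quot_ring
  quot_mulA quot_mul1q quot_mulq1 quot_mulDl quot_mulDr.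

Definition quot_pi (x : A) : quot_ring := \pi_quot_ring x.

Lemma quot_pi_zmod_morphism : zmod_morphism quot_pi.
Proof. exact: raddfB. Qed.

Lemma quot_pi_monoid_morphism : monoid_morphism quot_pi.
Proof. by split=> [|x y]; rewrite /quot_pi // -quot_mulE. Qed.

HB.instance Definition _ := GRing.isZmodMorphism.Build A quot_ring quot_pi
  quot_pi_zmod_morphism.
HB.instance Definition _ := GRing.isMonoidMorphism.Build A quot_ring quot_pi
  quot_pi_monoid_morphism.

End Quotient.

Record quiver := Quiver {
  vertex : finType;
  arrow : finType;
  source : arrow -> vertex;
  target : arrow -> vertex
}.

Definition is_loop (Q : quiver) (a : arrow Q) : Prop := source a = target a.

Section Paths.
Variable Q : quiver.

Fixpoint composable (x : vertex Q) (s : seq (arrow Q)) : bool :=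
  if s is a :: s' then (source a == x) && composable (target a) s' else true.

(* A path is its starting vertex together with the list of its arrows in the
   order in which they are traversed. *)
Record qpath := QPath {
  path_val :> vertex Q * seq (arrow Q);
  _ : composable path_val.1 path_val.2
}.

HB.instance Definition _ := [isSub for path_val].
HB.instance Definition _ := [Choice of qpath by <:].

Definition path_source (p : qpath) : vertex Q := p.1.
Definition path_arrows (p : qpath) : seq (arrow Q) := p.2.
Definition path_target (p : qpath) : vertex Q :=
  last (path_source p) (map (@target Q) (path_arrows p)).

Definition trivial_path (x : vertex Q) : qpath := @QPath (x, [::]) isT.

Lemma composable_arrow (a : arrow Q) : composable (source a) [:: a].
Proof. by rewrite /= eqxx. Qed.

Definition arrow_path (a : arrow Q) : qpath :=
  @QPath (source a, [:: a]) (composable_arrow a).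

Lemma composable_cat x s1 s2 :
  composable x (s1 ++ s2) =
  composable x s1 && composable (last x (map (@target Q) s1)) s2.
Proof. by elim: s1 x => //= a s1 IH x; rewrite IH andbA. Qed.

(* The product pq traverses p first, then q; None stands for the product 0.
   The opposite convention yields the path algebra of the opposite quiver. *)
Definition path_cat (p q : qpath) : option qpath :=
  if path_target p == path_source q
  then insub (path_source p, path_arrows p ++ path_arrows q) else None.

Lemma path_cat_val p q : path_target p = path_source q ->
  omap val (path_cat p q) = Some (path_source p, path_arrows p ++ path_arrows q).
Proof.
rewrite /path_cat => e; rewrite e eqxx; case: insubP => /= [u _ -> //|].
by rewrite composable_cat (valP p) -/(path_target p) e (valP q).
Qed.

End Paths.

Definition path_alg (k : fieldType) (Q : quiver) := {malg k[qpath Q]}.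

HB.instance Definition _ (k : fieldType) (Q : quiver) :=
  GRing.Zmodule.on (path_alg k Q).

HB.lock Definition path_elt (k : fieldType) (Q : quiver) (p : qpath Q) :
  path_alg k Q := << p >>.

Definition path_prod (k : fieldType) (Q : quiver) (p q : qpath Q) :
    path_alg k Q :=
  if path_cat p q is Some r then path_elt k r else 0.

HB.lock Definition pa_mul (k : fieldType) (Q : quiver) (f g : path_alg k Q) :
    path_alg k Q :=
  \sum_(p <- msupp f) \sum_(q <- msupp g) (f@_p * g@_q) *: path_prod k p q.

HB.lock Definition pa_one (k : fieldType) (Q : quiver) : path_alg k Q :=
  \sum_(x : vertex Q) path_elt k (trivial_path x).

Section PathAlgebra.
Variables (k : fieldType) (Q : quiver).

Local Notation path_alg := (path_alg k Q).
Local Notation path_elt := (path_elt k).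
Local Notation path_prod := (path_prod k).
Local Notation pa_mul := (@pa_mul k Q).
Local Notation pa_one := (pa_one k Q).

Implicit Types (f g h : path_alg) (p q r : qpath Q).

Lemma pa_mulw (d1 d2 : {fset qpath Q}) f g :
  (msupp f `<=` d1)%fset -> (msupp g `<=` d2)%fset ->
  pa_mul f g = \sum_(p <- d1) \sum_(q <- d2) (f@_p * g@_q) *: path_prod p q.
Proof.
move=> le1 le2; rewrite unlock (big_fset_incl _ le1) /=.
  apply/eq_bigr=> p _; apply/big_fset_incl => // q _ /mcoeff_outdom ->.
  by rewrite mulr0 scale0r.
move=> p _ /mcoeff_outdom fp; rewrite big1 // => q _.
by rewrite fp mul0r scale0r.
Qed.

Lemma pa_mulDl : left_distributive pa_mul +%R.
Proof.
move=> f g h.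
rewrite (pa_mulw (fsubsetUl (msupp f) (msupp g)) (fsubset_refl _)).
rewrite (pa_mulw (fsubsetUr (msupp f) (msupp g)) (fsubset_refl _)).
rewrite (pa_mulw (msuppD_le f g) (fsubset_refl _)) -big_split /=.
apply/eq_bigr=> p _; rewrite -big_split /=; apply/eq_bigr=> q _.
by rewrite mcoeffD mulrDl scalerDl.
Qed.

Lemma pa_mulDr : right_distributive pa_mul +%R.
Proof.
move=> f g h.
rewrite (pa_mulw (fsubset_refl _) (fsubsetUl (msupp g) (msupp h))).
rewrite (pa_mulw (fsubset_refl _) (fsubsetUr (msupp g) (msupp h))).
rewrite (pa_mulw (fsubset_refl _) (msuppD_le g h)) -big_split /=.
apply/eq_bigr=> p _; rewrite -big_split /=; apply/eq_bigr=> q _.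
by rewrite mcoeffD mulrDr scalerDl.
Qed.

Lemma pa_scaleAl (c : k) f g : c *: pa_mul f g = pa_mul (c *: f) g.
Proof.
rewrite (pa_mulw (msuppZ_le c f) (fsubset_refl _)) pa_mul.unlock scaler_sumr.
apply/eq_bigr=> p _; rewrite scaler_sumr; apply/eq_bigr=> q _.
by rewrite mcoeffZ scalerA mulrA.
Qed.

Lemma pa_scaleAr (c : k) f g : c *: pa_mul f g = pa_mul f (c *: g).
Proof.
rewrite (pa_mulw (fsubset_refl _) (msuppZ_le c g)) pa_mul.unlock scaler_sumr.
apply/eq_bigr=> p _; rewrite scaler_sumr; apply/eq_bigr=> q _.
by rewrite mcoeffZ scalerA mulrCA.
Qed.

Lemma pa_mulUU p q : pa_mul (path_elt p) (path_elt q) = path_prod p q.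
Proof.
rewrite !path_elt.unlock (pa_mulw msuppU_le msuppU_le) !big_seq_fset1 !mcoeffUU.
by rewrite mulr1 scale1r.
Qed.

Lemma pa_mul0g g : pa_mul 0 g = 0.
Proof. by rewrite -[0 in LHS](scale0r 0) -pa_scaleAl scale0r. Qed.

Lemma pa_mulg0 f : pa_mul f 0 = 0.
Proof. by rewrite -[0 in LHS](scale0r 0) -pa_scaleAr scale0r. Qed.

Lemma malgU_scale (K : choiceType) (R : nzRingType) (c : R) (x : K) :
  << c *g x >> = c *: << x >> :> {malg R[K]}.
Proof. by apply/malgP => y; rewrite mcoeffZ !mcoeffU mulr_natr. Qed.

Lemma pa_ind (P : path_alg -> Prop) :
  P 0 -> (forall f g, P f -> P g -> P (f + g)) ->
  (forall c p, P (c *: path_elt p)) -> forall f, P f.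
Proof.
move=> P0 PD PU f; rewrite [f]monalgE; elim/big_ind: _ => // p _.
suff -> : << f@_p *g p >> = f@_p *: path_elt p by [].
by rewrite path_elt.unlock; exact: malgU_scale.
Qed.

Lemma path_source_cat p q r : path_cat p q = Some r ->
  path_source r = path_source p.
Proof.
by rewrite /path_cat; case: eqP => // _; case: insubP => //= u _ e [<-];
  rewrite /path_source e.
Qed.

Lemma path_target_cat p q r : path_cat p q = Some r ->
  path_target r = path_target q.
Proof.
rewrite /path_cat; case: eqP => // e; case: insubP => //= u _ eu [<-].
rewrite /path_target /path_source /path_arrows eu /= map_cat last_cat.
by move: e; rewrite /path_target /path_source => ->.
Qed.

Lemma path_catA p q r :
  obind (fun u => path_cat u r) (path_cat p q) =
  obind (path_cat p) (path_cat q r).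
Proof.
case epq: (path_cat p q) => [u|]; case eqr: (path_cat q r) => [v|] //=.
- have tu := path_target_cat epq; have sv := path_source_cat eqr.
  have e1 : path_target p = path_source q.
    by apply/eqP; move: epq; rewrite /path_cat; case: ifP.
  have e2 : path_target q = path_source r.
    by apply/eqP; move: eqr; rewrite /path_cat; case: ifP.
  have Hu := path_cat_val e1; have Hv := path_cat_val e2.
  have H1 := path_cat_val (etrans tu e2).
  have H2 := path_cat_val (etrans e1 (esym sv)).
  apply: (inj_omap val_inj); rewrite H1 H2.
  move: Hu Hv; rewrite epq eqr /= => -[Hu] [Hv].
  by rewrite /path_source /path_arrows Hu Hv /= catA.
- move: eqr; rewrite /path_cat (path_target_cat epq).
  by case: eqP => // e; case: insubP => //=; rewrite composable_cat (valP q)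
    -/(path_target q) e (valP r).
- move: epq; rewrite /path_cat (path_source_cat eqr).
  by case: eqP => // e; case: insubP => //=; rewrite composable_cat (valP p)
    -/(path_target p) e (valP q).
Qed.

Lemma scale3_assoc (V : lmodType k) (m : V -> V -> V) :
  (forall c x y, c *: m x y = m (c *: x) y) ->
  (forall c x y, c *: m x y = m x (c *: y)) ->
  forall c d e x y z, m x (m y z) = m (m x y) z ->
  m (c *: x) (m (d *: y) (e *: z)) = m (m (c *: x) (d *: y)) (e *: z).
Proof.
move=> mZl mZr c d e x y z E.
have mE (a b : k) u v : m (a *: u) (b *: v) = a *: (b *: m u v).
  by rewrite -mZl -mZr.
rewrite (mE d e y z) (mE c d x y) (scalerA d e) (scalerA c d).
by rewrite (mE c) (mE (c * d)) E !scalerA mulrA.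
Qed.

Lemma pa_assoc_ext (m : path_alg -> path_alg -> path_alg) :
  left_distributive m +%R -> right_distributive m +%R ->
  left_zero 0 m -> right_zero 0 m ->
  (forall c f g, c *: m f g = m (c *: f) g) ->
  (forall c f g, c *: m f g = m f (c *: g)) ->
  (forall p q r, m (path_elt p) (m (path_elt q) (path_elt r)) =
                 m (m (path_elt p) (path_elt q)) (path_elt r)) ->
  associative m.
Proof.
move=> mDl mDr m0g mg0 mZl mZr mU.
elim/pa_ind=> [g h|f f' IH IH' g h|c p]; first by rewrite !m0g.
  by rewrite !mDl IH IH'.
elim/pa_ind=> [h|g g' IH IH' h|d q].
- by rewrite m0g mg0 m0g.
- by rewrite mDl !mDr mDl IH IH'.
elim/pa_ind=> [|h h' IH IH'|e r].
- by move: (c *: _) (d *: _) => u v; rewrite !mg0.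
- by move: (c *: _) (d *: _) IH IH' => u v IH IH'; rewrite !mDr IH IH'.
exact: (@scale3_assoc {malg k[qpath Q]} m mZl mZr c d e _ _ _ (mU p q r)).
Qed.

Lemma pa_mulA : associative pa_mul.
Proof.
apply: (pa_assoc_ext pa_mulDl pa_mulDr pa_mul0g pa_mulg0 pa_scaleAl pa_scaleAr).
move=> p q r; rewrite (pa_mulUU q r) (pa_mulUU p q) /path_prod.
have := path_catA p q r.
case: (path_cat p q) => [u|]; case: (path_cat q r) => [v|] /= e.
- by rewrite (pa_mulUU p v) (pa_mulUU u r) /path_prod e.
- by rewrite (pa_mulg0 (path_elt p)) (pa_mulUU u r) /path_prod e.
- by rewrite (pa_mul0g (path_elt r)) (pa_mulUU p v) /path_prod -e.
- by rewrite (pa_mul0g (path_elt r)) (pa_mulg0 (path_elt p)).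
Qed.

Lemma path_cat1p x p :
  path_cat (trivial_path x) p = if x == path_source p then Some p else None.
Proof.
rewrite /path_cat /path_target /=; case: eqP => // ->.
apply: (inj_omap val_inj); case: insubP => /= [u _ ->|].
  by rewrite /path_source /path_arrows; case: (val p).
by have := valP p; rewrite /path_source /path_arrows => ->.
Qed.

Lemma path_catp1 x p :
  path_cat p (trivial_path x) = if path_target p == x then Some p else None.
Proof.
rewrite /path_cat; case: eqP => // _; rewrite cats0.
apply: (inj_omap val_inj); case: insubP => /= [u _ ->|].
  by rewrite /path_source /path_arrows; case: (val p).
by have := valP p; rewrite /path_source /path_arrows => ->.
Qed.

Lemma pa_mul1U p : pa_mul pa_one (path_elt p) = path_elt p.
Proof.
rewrite pa_one.unlock (big_morph (fun f => pa_mul f (path_elt p))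
  (fun f g => pa_mulDl f g (path_elt p)) (pa_mul0g (path_elt p))).
transitivity (\sum_x path_prod (trivial_path x) p).
  by apply: eq_bigr => x _; exact: pa_mulUU.
rewrite (bigD1 (path_source p)) //= big1 => [|x /negPf ne].
  by rewrite /path_prod path_cat1p eqxx addr0.
by rewrite /path_prod path_cat1p ne.
Qed.

Lemma pa_mulU1 p : pa_mul (path_elt p) pa_one = path_elt p.
Proof.
rewrite pa_one.unlock (big_morph (pa_mul (path_elt p))
  (pa_mulDr (path_elt p)) (pa_mulg0 (path_elt p))).
transitivity (\sum_x path_prod p (trivial_path x)).
  by apply: eq_bigr => x _; exact: pa_mulUU.
rewrite (bigD1 (path_target p)) //= big1 => [|x /negPf ne].
  by rewrite /path_prod path_catp1 eqxx addr0.
by rewrite /path_prod path_catp1 eq_sym ne.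
Qed.

Lemma pa_mul1g : left_id pa_one pa_mul.
Proof.
elim/pa_ind=> [|f g IH IH'|c p]; first exact: (pa_mulg0 pa_one).
  by rewrite (pa_mulDr pa_one f g) IH IH'.
by rewrite -(pa_scaleAr c pa_one) pa_mul1U.
Qed.

Lemma pa_mulg1 : right_id pa_one pa_mul.
Proof.
elim/pa_ind=> [|f g IH IH'|c p]; first exact: (pa_mul0g pa_one).
  by rewrite (pa_mulDl f g pa_one) IH IH'.
by rewrite -(pa_scaleAl c _ pa_one) pa_mulU1.
Qed.

HB.instance Definition _ := GRing.Zmodule_isPzRing.Build path_alg
  pa_mulA pa_mul1g pa_mulg1 pa_mulDl pa_mulDr.

HB.instance Definition _ := GRing.Lmodule.on path_alg.

Definition pa_scalar (c : k) : path_alg := c *: (1 : path_alg).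

Lemma pa_scalar_zmod_morphism : zmod_morphism pa_scalar.
Proof. by move=> c d; rewrite /pa_scalar scalerBl. Qed.

Lemma pa_scalar_monoid_morphism : monoid_morphism pa_scalar.
Proof.
split=> [|c d]; rewrite /pa_scalar ?scale1r //.
rewrite -scalerA -[RHS](pa_scaleAl c 1 (d *: (1 : path_alg))).
congr (_ *: _); exact: esym (pa_mul1g _).
Qed.

HB.instance Definition _ := GRing.isZmodMorphism.Build k path_alg pa_scalar
  pa_scalar_zmod_morphism.
HB.instance Definition _ := GRing.isMonoidMorphism.Build k path_alg pa_scalar
  pa_scalar_monoid_morphism.

Definition arrow_elt (a : arrow Q) : path_alg := path_elt (arrow_path a).

Definition arrow_ideal : set path_alg := gen_ideal (range arrow_elt).

Definition admissible (I : ideal path_alg) : Prop :=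
  exists2 N : nat, (0 < N)%N &
    ideal_exp arrow_ideal N `<=` I /\ I `<=` ideal_exp arrow_ideal 2.

End PathAlgebra.

Arguments arrow_ideal : clear implicits.

(* N together with None as infinity. *)
Definition enat_le (x y : option nat) : bool :=
  if y is Some n then (if x is Some m then (m <= n)%N else false) else true.

Definition enat_inf (P : nat -> Prop) : option nat :=
  match pselect (exists n, `[< P n >]) with
  | left exP => Some (ex_minn exP)
  | right _ => None
  end.

(* The least upper bound in N with infinity adjoined; the empty set has 0. *)
Definition enat_sup (S : set (option nat)) : option nat :=
  enat_inf (fun n => forall d, S d -> enat_le d (Some n)).

Section Modules.
Variable A : pzRingType.

Definition projective (P : lmodType A) : Prop :=
  forall (M N : lmodType A) (g : {linear M -> N}) (f : {linear P -> N}),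
    (forall y, exists x, g x = y) -> exists h : {linear P -> M}, g \o h =1 f.

Definition exact_at (L M N : lmodType A)
    (f : {linear L -> M}) (g : {linear M -> N}) : Prop :=
  forall y, g y = 0 <-> exists x, f x = y.

Record proj_resolution (M : lmodType A) := ProjResolution {
  res_mod : nat -> lmodType A;
  res_diff : forall i, {linear res_mod i.+1 -> res_mod i};
  res_aug : {linear res_mod 0 -> M};
  res_projective : forall i, projective (res_mod i);
  res_aug_surj : forall y, exists x, res_aug x = y;
  res_exact0 : exact_at (res_diff 0) res_aug;
  res_exactS : forall i, exact_at (res_diff i.+1) (res_diff i)
}.

Definition res_length_le (M : lmodType A) (P : proj_resolution M) (n : nat) :=
  forall i, (n < i)%N -> forall x : res_mod P i, x = 0.

Definition pdim (M : lmodType A) : option nat :=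
  enat_inf (fun n => exists P : proj_resolution M, res_length_le P n).

End Modules.

(* A k-algebra is presented by its structure morphism iota : k -> A, whose image
   is central.  The algebra types of the library exclude the zero ring, which is
   the path algebra of the empty quiver. *)
Section GlobalDimension.
Variables (k : fieldType) (A : pzRingType) (iota : {rmorphism k -> A}).

Definition fin_dim (M : lmodType A) : Prop :=
  exists s : seq M, forall m : M, exists c : 'I_(size s) -> k,
    m = \sum_(i < size s) iota (c i) *: s`_i.

Definition gldim : option nat :=
  enat_sup [set d | exists2 M : lmodType A, fin_dim M & d = pdim M].

End GlobalDimension.

Definition quot_scalar (k : fieldType) (Q : quiver) (I : ideal (path_alg k Q)) :
    {rmorphism k -> quot_ring I} :=
  @quot_pi _ I \o @pa_scalar k Q.

(* Main.v *)
Require Import Defs.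
From HB Require Import structures.
From mathcomp Require Import all_boot all_algebra.
From mathcomp Require Import finmap monalg.
From mathcomp Require Import boolp classical_sets.

Set Implicit Arguments.
Unset Strict Implicit.
Unset Printing Implicit Defensive.

Import GRing.Theory.
Local Open Scope classical_set_scope.
Local Open Scope ring_scope.

(** Write A = kQ/I, with e_x the trivial path at x, and S_x the simple module
    at x; a product ab traverses a first.

    A loop forces the global dimension away from 2 by a trace argument
    (Hattori, Stallings, Lenzing).  If a is a loop at x and I lies in
    (kQ^+)^2, then the coefficient of a is a linear form tau on A, and
    tau (uv) = tau (vu): both sides are u_x v_a + u_a v_x, where u_x and v_x
    are the coefficients of e_x.  Such a form gives a trace to every
    endomorphism of a finitely generated projective module, and hence, by an
    alternating sum over lifts to a finite resolution, to every endomorphism f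
    of a finite-dimensional module M, provided that all these modules have
    projective dimension at most 2.  Lifts are unique up to homotopy, so the
    trace is well defined, and it satisfies tr (fg) = tr (gf).  Factoring f as
    M -> im f -> M therefore gives f and its restriction to im f the same
    trace, and a nilpotent f has trace 0 ([nilpotent_lifting_trace]).  Right
    multiplication by the nilpotent element a on A, however, has trace
    tau a = 1 ([loop_not_pd_le2]).

    The other direction uses ideals generated by a set R of paths ab of length
    two.  Ending a path with a given arrow is injective up to the relations, so
    the kernel of A e_x -> S_x is the direct sum of the modules A b over the
    arrows b that end at x, and the annihilator of b is the sum of
    A (1 - e_(s b)) and of the A a with ab in R.  When no two relations overlap,
    such an A a is isomorphic to A e_(s a), which is projective; so S_x has
    projective dimension at most 2, and at most 1 when R is empty
    ([simple_pd_le2], [simple_pd_le1]).  Finite-dimensional modules are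
    iterated extensions of the S_x, and projective dimension does not grow
    under extensions ([pd_le_ext]).  If R contains ab, then A/Ab does not have
    projective dimension at most 1: otherwise the annihilator of b would be
    generated by an idempotent e, and the coefficient of the trivial path in e
    would be 0 because eb = 0, and 1 because ae = a.

    If (kQ^+)^2 = 0 then I = 0 is the case R empty, so the global dimension is
    at most 1.  If Q has no loops and a path of length two, rank the vertices
    injectively with the middle vertex of that path on top, and let R consist
    of the peaks: an arrow that goes up followed by one that goes down.  A path
    without peaks goes down and then up, so its length is bounded and the ideal
    is admissible; two peaks cannot overlap, since the shared arrow would have
    to go both ways; and R is not empty by the choice of the ranking. *)

(** * Linear maps, submodules and quotient modules *)

Section LinearMaps.
Variable A : pzRingType.
Implicit Types K M N P X Y : lmodType A.

Definition surj M N (f : M -> N) : Prop := forall y, exists x, f x = y.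

Definition lin_of M N (f : M -> N) (lin_f : linear f) : {linear M -> N} :=
  HB.pack f (GRing.isLinear.Build A M N *:%R f lin_f).

Lemma lin_ofE M N (f : M -> N) (lin_f : linear f) x : lin_of lin_f x = f x.
Proof. by []. Qed.

Lemma lin_inj M N (f : {linear M -> N}) :
  (forall x, f x = 0 -> x = 0) -> injective f.
Proof.
move=> ker_f x y e; apply/eqP; rewrite -subr_eq0; apply/eqP/ker_f.
by rewrite linearB e subrr.
Qed.

Lemma lin_factor K X P (r : {linear P -> K}) (g : {linear P -> X}) :
  surj r -> (forall z, r z = 0 -> g z = 0) ->
  exists h : {linear K -> X}, forall z, h (r z) = g z.
Proof.
move=> r_surj ker_rg; have [s sK] := choice r_surj.
have gE z z' : r z = r z' -> g z = g z'.
  move=> e; apply/eqP; rewrite -subr_eq0 -linearB; apply/eqP/ker_rg.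
  by rewrite linearB e subrr.
have lin_h : linear (fun x => g (s x)).
  by move=> a x y; rewrite -linearP; apply: gE; rewrite linearP !sK.
by exists (lin_of lin_h) => z; apply: gE; rewrite sK.
Qed.

End LinearMaps.

Section Submodules.
Variables (A : pzRingType) (M : lmodType A).

Record submodule := Submodule {
  submodule_pred : {pred M};
  submoduleP : submod_closed submodule_pred }.

Definition submod_mem (S : submodule) : {pred M} := submodule_pred S.

HB.instance Definition _ (S : submodule) :=
  GRing.isSubmodClosed.Build A M (submod_mem S) (submoduleP S).

Definition submod_of (S : submodule) := {x : M | x \in submod_mem S}.

HB.instance Definition _ (S : submodule) := SubType.on (submod_of S).
HB.instance Definition _ (S : submodule) := Choice.on (submod_of S).
HB.instance Definition _ (S : submodule) :=
  [SubChoice_isSubLmodule of submod_of S by <:].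

Section Quotient.
Variable S : submodule.

Definition quot_mod := Quotient.quot (submod_mem S).
HB.instance Definition _ := GRing.Zmodule.on quot_mod.
HB.instance Definition _ := EqQuotient.on quot_mod.
HB.instance Definition _ := ZmodQuotient.on quot_mod.

Let pi (x : M) : quot_mod := \pi_quot_mod%qT x.

Lemma quot_mod_pi_eq x y : pi x = pi y <-> x - y \in submod_mem S.
Proof.
by split=> [/eqP|Sxy]; [|apply/eqP]; rewrite /pi -Quotient.idealrBE.
Qed.

Let piD x y : pi (x + y) = pi x + pi y.
Proof. exact: raddfD. Qed.

Let quot_modP x : exists y, x = pi y.
Proof. by exists (repr x); rewrite /pi reprK. Qed.

Let scale (a : A) (x : quot_mod) : quot_mod := pi (a *: repr x).

Let scale_pi a x : scale a (pi x) = pi (a *: x).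
Proof.
apply/quot_mod_pi_eq; rewrite -scalerBr rpredZ //.
by apply/quot_mod_pi_eq; rewrite /pi reprK.
Qed.

Let scaleA a b v : scale a (scale b v) = scale (a * b) v.
Proof. by have [x ->] := quot_modP v; rewrite !scale_pi scalerA. Qed.

Let scale1 : left_id 1 scale.
Proof. by move=> v; have [x ->] := quot_modP v; rewrite scale_pi scale1r. Qed.

Let scaleDr : right_distributive scale +%R.
Proof.
move=> a v w; have [x ->] := quot_modP v; have [y ->] := quot_modP w.
by rewrite -piD !scale_pi scalerDr piD.
Qed.

Let scaleDl v : {morph scale^~ v : a b / a + b}.
Proof.
by move=> a b; have [x ->] := quot_modP v; rewrite !scale_pi scalerDl piD.
Qed.

HB.instance Definition _ :=
  GRing.Zmodule_isLmodule.Build A quot_mod scaleA scale1 scaleDr scaleDl.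

Lemma quot_mod_pi_linear : linear pi.
Proof. by move=> a x y; rewrite piD -scale_pi. Qed.

Lemma quot_mod_exists :
  exists (N : lmodType A) (g : {linear M -> N}),
    surj g /\ forall x, g x = 0 <-> x \in submod_mem S.
Proof.
exists quot_mod, (lin_of quot_mod_pi_linear); split=> [y|x].
  by have [x ->] := quot_modP y; exists x.
have -> : (0 : quot_mod) = pi 0 by rewrite /pi raddf0.
by rewrite lin_ofE quot_mod_pi_eq subr0.
Qed.

End Quotient.
End Submodules.

Lemma ker_submod (A : pzRingType) (M N : lmodType A) (f : {linear M -> N}) :
  submod_closed [pred x | f x == 0].
Proof.
split=> [|a x y]; rewrite !inE ?raddf0 // => /eqP fx /eqP fy.
by rewrite linearP fx fy scaler0 addr0.
Qed.

Definition ker (A : pzRingType) (M N : lmodType A) (f : {linear M -> N}) :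
  lmodType A := submod_of (Submodule (ker_submod f)).

HB.lock Definition ker_val (A : pzRingType) (M N : lmodType A)
    (f : {linear M -> N}) : {linear ker f -> M} :=
  [the {linear ker f -> M} of \val].

Lemma im_submod (A : pzRingType) (M N : lmodType A) (f : {linear M -> N}) :
  submod_closed [pred y | `[< exists x, f x = y >]].
Proof.
split=> [|a x y]; rewrite !inE.
  by exists 0; exact: raddf0.
by move=> [u <-] [v <-]; exists (a *: u + v); rewrite linearP.
Qed.

Definition im (A : pzRingType) (M N : lmodType A) (f : {linear M -> N}) :
  lmodType A := submod_of (Submodule (im_submod f)).

HB.lock Definition im_val (A : pzRingType) (M N : lmodType A)
    (f : {linear M -> N}) : {linear im f -> N} :=
  [the {linear im f -> N} of \val].

Section KernelImage.
Variable A : pzRingType.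
Implicit Types M N P X : lmodType A.

Lemma ker_val_inj M N (f : {linear M -> N}) : injective (ker_val f).
Proof. by rewrite unlock; exact: val_inj. Qed.

Lemma ker_valK M N (f : {linear M -> N}) x : f (ker_val f x) = 0.
Proof. by rewrite unlock; apply/eqP; exact: (valP x). Qed.

Lemma ker_intro M N (f : {linear M -> N}) x :
  f x = 0 -> exists y, ker_val f y = x.
Proof.
move=> /eqP fx; have fx' : x \in submod_mem (Submodule (ker_submod f)) by [].
by exists (Sub x fx'); rewrite unlock; exact: SubK.
Qed.

Lemma im_val_inj M N (f : {linear M -> N}) : injective (im_val f).
Proof. by rewrite unlock; exact: val_inj. Qed.

(** The inverse of an injective linear map on its image is linear; this is how
    maps into kernels and images are built. *)
Lemma inj_lift M N P (i : {linear M -> N}) (g : {linear P -> N}) :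
  injective i -> (forall x, exists y, i y = g x) ->
  exists h : {linear P -> M}, forall x, i (h x) = g x.
Proof.
move=> i_inj /choice[h hE].
have lin_h : linear h.
  by move=> a x y; apply: i_inj; rewrite linearP !hE linearP.
by exists (lin_of lin_h).
Qed.

Lemma ker_lift M N P (f : {linear M -> N}) (g : {linear P -> M}) :
  (forall x, f (g x) = 0) ->
  exists h : {linear P -> ker f}, forall x, ker_val f (h x) = g x.
Proof.
by move=> fg; apply: inj_lift (@ker_val_inj _ _ f) _ => x; exact: ker_intro.
Qed.

Lemma im_corestr M N (f : {linear M -> N}) :
  exists h : {linear M -> im f},
    surj h /\ forall x, im_val f (h x) = f x.
Proof.
have [x|h hE] := inj_lift (g := f) (@im_val_inj _ _ f).
  have fx : f x \in submod_mem (Submodule (im_submod f)).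
    by apply/asboolP; exists x.
  by exists (Sub (f x) fx); rewrite unlock; exact: SubK.
exists h; split=> // y; have /asboolP[x fx] := valP y.
by exists x; apply: im_val_inj; rewrite hE unlock.
Qed.

End KernelImage.

(** * Projective modules *)

Section Projectives.
Variable A : pzRingType.
Implicit Types K L M N P Q F X Y Z : lmodType A.

Lemma projective_lift P M N (g : {linear M -> N}) (f : {linear P -> N}) :
  projective P -> surj g ->
  exists h : {linear P -> M}, forall x, g (h x) = f x.
Proof.
by move=> P_proj g_surj; have [h hE] := P_proj _ _ g f g_surj; exists h.
Qed.

Lemma projective_lift_exact P X Y Z (d : {linear X -> Y}) (e : {linear Y -> Z})
    (f : {linear P -> Y}) :
  projective P -> (forall y, e y = 0 -> exists x, d x = y) ->
  (forall x, e (f x) = 0) ->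
  exists h : {linear P -> X}, forall x, d (h x) = f x.
Proof.
move=> P_proj exact_de ef0.
have [d' [d'_surj d'E]] := im_corestr d.
have [|f' f'E] := inj_lift (g := f) (@im_val_inj _ _ _ d).
  by move=> x; have [z <-] := exact_de _ (ef0 x); exists (d' z).
have [h hE] := projective_lift f' P_proj d'_surj.
by exists h => x; rewrite -d'E hE f'E.
Qed.

(** Since e vanishes on the kernel of r and r e = r, it induces a section of
    r: K is a retract of F. *)
Lemma projective_image F K (r : {linear F -> K}) (e : {linear F -> F}) :
  projective F -> surj r ->
  (forall x, r (e x) = r x) -> (forall x, r x = 0 -> e x = 0) -> projective K.
Proof.
move=> F_proj r_surj re ker_re M N g f g_surj.
have [h hE] := projective_lift (f \o r) F_proj g_surj.
have [x rx|h' h'E] := lin_factor (g := h \o e) r_surj.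
  by rewrite /= ker_re // linear0.
exists h' => y /=; have [x <-] := r_surj y.
by rewrite h'E /= hE /= re.
Qed.

Lemma projective_retract F K (i : {linear K -> F}) (r : {linear F -> K}) :
  projective F -> (forall x, r (i x) = x) -> projective K.
Proof.
move=> F_proj riK; apply: (@projective_image F K r (i \o r)) => //=.
- by move=> x; exists (i x).
- by move=> x rx; rewrite rx linear0.
Qed.

Lemma projective_regular : projective A^o.
Proof.
move=> M N g f g_surj; have [m gm] := g_surj (f 1).
have lin_h : linear (fun a : A^o => a *: m).
  by move=> a x y; rewrite scalerDl -scalerA.
exists (lin_of lin_h) => a /=; rewrite linearZ gm -linearZ.
by congr (f _); exact: mulr1.
Qed.

Lemma projective_ffun (I : finType) P :
  projective P -> projective {ffun I -> P}.
Proof.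
move=> P_proj M N g f g_surj.
pose d (i : I) (x : P) : {ffun I -> P} := [ffun j => if j == i then x else 0].
have lin_d i : linear (d i).
  move=> a x y; apply/ffunP=> j; rewrite !ffunE.
  by case: ifP => // _; rewrite scaler0 addr0.
have /choice[h hE] i : exists h : {linear P -> M}, forall x, g (h x) = f (d i x).
  exact: (projective_lift (f \o lin_of (lin_d i)) P_proj g_surj).
have lin_h : linear (fun v : {ffun I -> P} => \sum_i h i (v i)).
  move=> a x y; rewrite scaler_sumr -big_split; apply: eq_bigr => i _ /=.
  by rewrite !ffunE linearP.
exists (lin_of lin_h) => v /=; rewrite linear_sum.
have {2}-> : v = \sum_i d i (v i).
  apply/ffunP=> j; rewrite sum_ffunE (bigD1 j) //= big1 => [|i /negPf ij].
    by rewrite ffunE eqxx addr0.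
  by rewrite ffunE eq_sym ij.
by rewrite linear_sum; apply: eq_bigr => i _; exact: hE.
Qed.

Lemma projective_prod P P' :
  projective P -> projective P' -> projective (P * P')%type.
Proof.
move=> P_proj P'_proj M N g f g_surj.
have lin1 : linear (fun x : P => (x, 0 : P')).
  by move=> a x y; apply: injective_projections => /=; rewrite ?scaler0 ?addr0.
have lin2 : linear (fun x : P' => (0 : P, x)).
  by move=> a x y; apply: injective_projections => /=; rewrite ?scaler0 ?addr0.
have [h1 h1E] := projective_lift (f \o lin_of lin1) P_proj g_surj.
have [h2 h2E] := projective_lift (f \o lin_of lin2) P'_proj g_surj.
have lin_h : linear (fun x : P * P' => h1 x.1 + h2 x.2).
  move=> a [x x'] [y y'] /=.
  by rewrite !linearP scalerDr addrACA.
exists (lin_of lin_h) => -[x y] /=; rewrite linearD h1E h2E /= -linearD.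
by congr (f (_, _)); rewrite ?addr0 ?add0r.
Qed.

(** Projective dimension at most n, by shifting along one projective cover;
    [pd_le_ker] shows that the choice of the cover is immaterial. *)
Fixpoint pd_le n M : Prop :=
  if n is n'.+1 then
    exists (P : lmodType A) (f : {linear P -> M}),
      [/\ projective P, surj f & pd_le n' (ker f)]
  else projective M.

Lemma pd_le_iso n M N (f : {linear M -> N}) :
  injective f -> surj f -> pd_le n M -> pd_le n N.
Proof.
elim: n M N f => [|n IH] M N f f_inj f_surj /=.
  move=> M_proj; apply: (@projective_image M N f idfun) => // x.
  by rewrite -{1}(linear0 f) => /f_inj.
move=> [P [g [P_proj g_surj Kg]]]; exists P, (f \o g); split=> //.
  by move=> y; have [x <-] := f_surj y; have [z <-] := g_surj x; exists z.
have [|h hE] := @ker_lift _ _ _ _ (f \o g) (ker_val g).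
  by move=> x; rewrite /= ker_valK linear0.
apply: (IH _ _ h) => //.
  by move=> x y e; apply: ker_val_inj; rewrite -!hE e.
move=> y; have /(_ (ker_val (f \o g) y))[|x xE] := @ker_intro _ _ _ g.
  by apply: f_inj; rewrite linear0; exact: (ker_valK (f := f \o g)).
by exists x; apply: ker_val_inj; rewrite hE.
Qed.

Lemma projective_pd_le n P : projective P -> pd_le n P.
Proof.
elim: n P => [|n IH] P P_proj //=; exists P, idfun; split=> //.
  by move=> y; exists y.
apply: IH; apply: (@projective_retract P _ (ker_val _) \0) => // x.
apply: ker_val_inj; rewrite linear0; exact: (esym (ker_valK x)).
Qed.

(** The horseshoe lemma: projective covers of L and N combine into one of M,
    and the kernels form an exact sequence again. *)
Lemma pd_le_ext n L M N (i : {linear L -> M}) (g : {linear M -> N}) :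
  injective i -> surj g -> (forall y, g y = 0 <-> exists x, i x = y) ->
  pd_le n L -> pd_le n N -> pd_le n M.
Proof.
elim: n L M N i g => [|n IH] L M N i g i_inj g_surj exact_ig /=.
  move=> L_proj N_proj; have [s gs] := projective_lift idfun N_proj g_surj.
  have lin_f : linear (fun x : L * N => i x.1 + s x.2).
    by move=> a [x x'] [y y'] /=; rewrite !linearP scalerDr addrACA.
  apply: (@pd_le_iso 0 _ _ (lin_of lin_f)); last exact: projective_prod.
    apply: lin_inj => -[x y] /= e.
    have gi z : g (i z) = 0 by apply/exact_ig; exists z.
    have y0 : y = 0 by have := congr1 g e; rewrite linearD gi gs linear0 add0r.
    move: e; rewrite y0 linear0 addr0 => e; congr (_, _).
    by apply: i_inj; rewrite e linear0.
  move=> y; have [|x xE] := (exact_ig (y - s (g y))).1.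
    by rewrite linearB gs subrr.
  by exists (x, g y); rewrite /= xE subrK.
move=> [P [f [P_proj f_surj Kf]]] [Q [h [Q_proj h_surj Kh]]].
have [l lE] := projective_lift h Q_proj g_surj.
have lin_u : linear (fun x : P * Q => i (f x.1) + l x.2).
  by move=> a [x x'] [y y'] /=; rewrite !linearP scalerDr addrACA.
pose u := lin_of lin_u; exists (P * Q)%type, u.
have gu x : g (u x) = h x.2.
  by rewrite /= linearD lE; have -> : g (i (f x.1)) = 0;
    [apply/exact_ig; exists (f x.1) | rewrite add0r].
split; first exact: projective_prod.
  move=> y; have [q qE] := h_surj (g y); have [|x xE] := (exact_ig (y - l q)).1.
    by rewrite linearB lE qE subrr.
  have [p pE] := f_surj x; exists (p, q).
  by rewrite /= pE xE subrK.
have lin1 : linear (fun x : P => (x, 0 : Q)).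
  by move=> a x y; apply: injective_projections => /=; rewrite ?scaler0 ?addr0.
have lin2 : linear (@snd P Q) by [].
have [x|j jE] := @ker_lift _ _ _ _ u (lin_of lin1 \o ker_val f).
  by rewrite /= ker_valK !linear0 addr0.
have [x|k kE] := @ker_lift _ _ _ _ h (lin_of lin2 \o ker_val u).
  by rewrite /= -gu ker_valK linear0.
apply: (IH _ _ _ j k) => //.
- move=> x y e; apply: ker_val_inj.
  by have := congr1 (ker_val u) e; rewrite !jE => -[].
- move=> y; have hy := ker_valK y.
  have [|p pE] := (exact_ig (- l (ker_val h y))).1.
    by rewrite linearN lE hy oppr0.
  have [p' p'E] := f_surj p.
  have [|z zE] := @ker_intro _ _ _ u (p', ker_val h y).
    by rewrite /= p'E pE addNr.
  by exists z; apply: ker_val_inj; rewrite kE /= zE.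
move=> y; split=> [ky|[x <-]]; last first.
  by apply: ker_val_inj; rewrite kE linear0 /= jE.
have y2 : (ker_val u y).2 = 0 by have := kE y; rewrite ky linear0.
have [|x xE] := @ker_intro _ _ _ f (ker_val u y).1.
  apply: i_inj; rewrite linear0; have := ker_valK y.
  by rewrite /= y2 linear0 addr0.
exists x; apply: ker_val_inj; rewrite jE /= xE.
by rewrite [RHS]surjective_pairing y2.
Qed.

(** Both covers of M are compared through their fibre product. Splitting off
    the summand Q requires closure under retracts in the same dimension, which
    [pd_le_retract] in turn derives from the present lemma one dimension
    lower; hence the first hypothesis. *)
Lemma schanuel n M P (f : {linear P -> M}) :
  (forall X K (i : {linear K -> X}) (r : {linear X -> K}),
     (forall x, r (i x) = x) -> pd_le n X -> pd_le n K) ->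
  projective P -> surj f -> pd_le n.+1 M -> pd_le n (ker f).
Proof.
move=> retract P_proj f_surj [Q [g [Q_proj g_surj Kg]]].
have lin_d : linear (fun x : P * Q => f x.1 - g x.2).
  move=> a [x x'] [y y'] /=.
  by rewrite !linearP scalerDr addrACA.
pose d := lin_of lin_d.
have lin1 : linear (@fst P Q) by [].
have lin2 : linear (@snd P Q) by [].
have lin1' : linear (fun x : P => (x, 0 : Q)).
  by move=> a x y; apply: injective_projections => /=; rewrite ?scaler0 ?addr0.
have lin2' : linear (fun x : Q => (0 : P, x)).
  by move=> a x y; apply: injective_projections => /=; rewrite ?scaler0 ?addr0.
have dE x : f (ker_val d x).1 = g (ker_val d x).2.
  by apply/eqP; rewrite -subr_eq0; apply/eqP/(ker_valK x).
(* The fibre product of P and Q over M is an extension of P by ker g. *)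
have pdX : pd_le n (ker d).
  have [x|j jE] := @ker_lift _ _ _ _ d (lin_of lin2' \o ker_val g).
    by rewrite /= ker_valK linear0 subrr.
  apply: (@pd_le_ext n _ _ _ j (lin_of lin1 \o ker_val d)) => //.
  - move=> x y e; apply: ker_val_inj.
    by have := congr1 (ker_val d) e; rewrite !jE => -[].
  - move=> p; have [q qE] := g_surj (f p).
    have [|z zE] := @ker_intro _ _ _ d (p, q); first by rewrite /= qE subrr.
    by exists z; rewrite /= zE.
  - move=> y; split=> [y1|[x <-]]; last by rewrite /= jE.
    have {}y1 : (ker_val d y).1 = 0 := y1.
    have [|x xE] := @ker_intro _ _ _ g (ker_val d y).2.
      by rewrite -dE y1 linear0.
    exists x; apply: ker_val_inj; rewrite jE /= xE.
    by rewrite [RHS]surjective_pairing y1.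
  - exact: projective_pd_le.
(* It projects onto Q with kernel ker f, and this projection splits. *)
have [l lE] := projective_lift g Q_proj f_surj.
have [x|i iE] := @ker_lift _ _ _ _ d (lin_of lin1' \o ker_val f).
  by rewrite /= ker_valK linear0 subr0.
have lin_t : linear (fun x : ker d => (ker_val d x).1 - l (ker_val d x).2).
  by move=> a x y; rewrite !linearP /= ?linearP scalerDr addrACA.
have [x|r rE] := @ker_lift _ _ _ _ f (lin_of lin_t).
  by rewrite /= linearB lE dE subrr.
apply: (retract _ _ i r) pdX => x; apply: ker_val_inj.
by rewrite rE /= iE /= linear0 subr0.
Qed.

(** The idempotent i r and its complement, each composed with f, give a cover
    of X by P * P whose kernel has that of r f as a retract. *)
Lemma pd_le_retract n X K (i : {linear K -> X}) (r : {linear X -> K}) :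
  (forall x, r (i x) = x) -> pd_le n X -> pd_le n K.
Proof.
elim: n X K i r => [|n IH] X K i r riK.
  by move=> X_proj; exact: projective_retract X_proj riK.
move=> pdX; have [P [f [P_proj f_surj _]]] := pdX.
exists P, (r \o f); split=> //.
  by move=> y; have [x xE] := f_surj (i y); exists x; rewrite /= xE riK.
have lin_g : linear (fun x : P * P => i (r (f x.1)) + (f x.2 - i (r (f x.2)))).
  move=> a [x x'] [y y'] /=; rewrite !linearP !scalerDr.
  by rewrite [X in _ + X = _]addrACA [LHS]addrACA.
pose g := lin_of lin_g.
have rg x : r (g x) = r (f x.1).
  by rewrite /= linearD linearB !riK subrr addr0.
have g_surj : surj g.
  move=> y; have [x xE] := f_surj y; exists (x, x).
  by rewrite /= xE addrC subrK.
have Kg := schanuel (fun X K => IH X K) (projective_prod P_proj P_proj) g_surj pdX.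
have lin1 : linear (@fst P P) by [].
have lin1' : linear (fun x : P => (x, 0 : P)).
  by move=> a x y; apply: injective_projections => /=; rewrite ?scaler0 ?addr0.
have [x|j jE] := @ker_lift _ _ _ _ g (lin_of lin1' \o ker_val (r \o f)).
  by have := ker_valK x; rewrite /= => ->; rewrite !linear0 !addr0.
have [x|q qE] := @ker_lift _ _ _ _ (r \o f) (lin_of lin1 \o ker_val g).
  by rewrite /= -rg ker_valK linear0.
apply: (IH _ _ j q) Kg => x; apply: ker_val_inj.
by rewrite qE /= jE.
Qed.

Lemma pd_le_ker n M P (f : {linear P -> M}) :
  projective P -> surj f -> pd_le n.+1 M -> pd_le n (ker f).
Proof. by apply: schanuel => X K i r; exact: pd_le_retract. Qed.

End Projectives.

(** * Projective dimension and resolutions *)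

Section Resolutions.
Variable A : pzRingType.
Implicit Types M N P : lmodType A.

Let zero_mod : lmodType A := {ffun void -> A^o}.

Let zero_modP (x : zero_mod) : x = 0.
Proof. by apply/ffunP => -[]. Qed.

Lemma pd_le_has_resolution n M :
  pd_le n M -> exists P : proj_resolution M, res_length_le P n.
Proof.
elim: n M => [|n IH] M /=.
  move=> M_proj.
  pose mod i : lmodType A := if i is 0%N then M else zero_mod.
  pose diff i : {linear mod i.+1 -> mod i} := lin_of (fun a x y =>
    esym (etrans (addr0 _) (scaler0 _ a)) : (0 : mod i) = a *: 0 + 0).
  have mod_proj i : projective (mod i).
    by case: i => [//|i] /=; exact/projective_ffun/projective_regular.
  have aug_surj y : exists x : mod 0%N, (idfun : {linear mod 0%N -> M}) x = y.
    by exists y.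
  have ex0 : exact_at (diff 0%N) (idfun : {linear mod 0%N -> M}).
    by move=> y; split=> [/= ->|[x <-]] //; exists 0.
  have exS i : exact_at (diff i.+1) (diff i).
    by move=> y; split=> // _; exists 0; rewrite [y]zero_modP.
  exists (ProjResolution mod_proj aug_surj ex0 exS).
  by case=> // i _ x; exact: zero_modP.
move=> [P [f [P_proj f_surj /IH[R Rn]]]].
pose mod i := if i is j.+1 then res_mod R j else P.
pose diff i : {linear mod i.+1 -> mod i} :=
  if i is j.+1 return {linear mod i.+1 -> mod i} then res_diff R j
  else ker_val f \o res_aug R.
have mod_proj i : projective (mod i).
  by case: i => [//|i] /=; exact: res_projective.
have ex0 : exact_at (diff 0%N) (f : {linear mod 0%N -> M}).
  move=> y; split=> [/ker_intro[k <-]|[x <-]]; last exact: ker_valK.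
  by have [x <-] := res_aug_surj R k; exists x.
have exS i : exact_at (diff i.+1) (diff i).
  case: i => [|i] y; last exact: res_exactS.
  split=> [|e]; last by rewrite /= ((@res_exact0 _ _ R y).2 e) linear0.
  rewrite /= -(linear0 (ker_val f)) => /ker_val_inj.
  by move=> e; exact: (@res_exact0 _ _ R y).1.
exists (ProjResolution mod_proj f_surj ex0 exS).
by case=> // i /= lt_ni x; exact: Rn.
Qed.

Lemma resolution_pd_le n M (P : proj_resolution M) :
  res_length_le P n -> pd_le n M.
Proof.
elim: n M P => [|n IH] M P Pn /=.
  apply: (@pd_le_iso _ 0 _ _ (res_aug P)); last exact: res_projective.
    apply: lin_inj => x e; have [y <-] := (@res_exact0 _ _ P x).1 e.
    by rewrite (Pn 1%N isT y) linear0.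
  exact: res_aug_surj.
exists (res_mod P 0%N), (res_aug P).
split; [exact: res_projective | exact: res_aug_surj |].
have [x|aug augE] := @ker_lift _ _ _ _ (res_aug P) (res_diff P 0%N).
  by apply: (@res_exact0 _ _ P _).2; exists x.
have aug_surj y : exists x, aug x = y.
  have [x xE] := (@res_exact0 _ _ P _).1 (ker_valK y).
  by exists x; apply: ker_val_inj; rewrite augE.
have ex0 : exact_at (res_diff P 1%N) aug.
  move=> y; rewrite -(@res_exactS _ _ P 0 y) -augE.
  split=> [->|]; first exact: linear0.
  by rewrite -(linear0 (ker_val (res_aug P))) => /ker_val_inj.
pose R := @ProjResolution _ (ker (res_aug P)) (fun i => res_mod P i.+1)
  (fun i => res_diff P i.+1) aug (fun i => @res_projective _ _ P i.+1)
  aug_surj ex0 (fun i => @res_exactS _ _ P i.+1).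
by apply: (IH _ R) => i lt_ni x; exact: (Pn i.+1).
Qed.

Lemma enat_inf_le (p : nat -> Prop) n :
  (forall i j, (i <= j)%N -> p i -> p j) ->
  enat_le (enat_inf p) (Some n) <-> p n.
Proof.
move=> p_mono; rewrite /enat_inf; case: pselect => [exP|nexP] /=.
  case: ex_minnP => m /asboolP pm m_min; split=> [le_mn|pn].
    exact: p_mono pm.
  by apply/m_min/asboolP.
by split=> // pn; case: nexP; exists n; apply/asboolP.
Qed.

Lemma pdim_le M n : enat_le (pdim M) (Some n) <-> pd_le n M.
Proof.
rewrite enat_inf_le; last first.
  move=> i j le_ij [P Pi]; exists P => l lt_jl; apply: Pi.
  exact: leq_ltn_trans lt_jl.
by split=> [[P]|]; [exact: resolution_pd_le | exact: pd_le_has_resolution].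
Qed.

Lemma pd_leW m n M : (m <= n)%N -> pd_le m M -> pd_le n M.
Proof.
move=> le_mn /pd_le_has_resolution[P Pm]; apply: (@resolution_pd_le _ _ P).
by move=> i lt_ni; apply: Pm; exact: leq_ltn_trans lt_ni.
Qed.

End Resolutions.

(** Being of projective dimension at most m for all finite-dimensional modules
    is upward closed in m, so the value n.+1 is characterised at n.+1 and n.
    *)
Lemma gldim_eqS (k : fieldType) (A : pzRingType) (iota : {rmorphism k -> A}) n :
  gldim iota = Some n.+1 <->
  (forall M : lmodType A, fin_dim iota M -> pd_le n.+1 M) /\
  ~ (forall M : lmodType A, fin_dim iota M -> pd_le n M).
Proof.
pose p m := forall M : lmodType A, fin_dim iota M -> pd_le m M.
have p_mono i j : (i <= j)%N -> p i -> p j.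
  by move=> le_ij pi M /pi; exact: pd_leW.
have -> : gldim iota = enat_inf p.
  congr enat_inf; apply/funext => m; apply/propext; split=> [h M Mfd|pm d].
    by apply/pdim_le; apply: h; exists M.
  by move=> [M Mfd ->]; apply/pdim_le; exact: pm.
have le_p m : enat_le (enat_inf p) (Some m) <-> p m by exact: enat_inf_le.
split=> [e|[pn1 npn]].
  split; first by apply/le_p; rewrite e /=.
  by move/le_p; rewrite e /= ltnn.
move/le_p: pn1; have : ~ enat_le (enat_inf p) (Some n) by move/le_p.
case: (enat_inf p) => [m|] //= /negP; rewrite -ltnNge => lt_nm le_mn.
by congr Some; apply/eqP; rewrite eqn_leq le_mn.
Qed.

(** * Finite-dimensional modules *)

Section FiniteDimension.
Variables (k : fieldType) (A : pzRingType) (iota : {rmorphism k -> A}).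
Implicit Types K M N P : lmodType A.

(** The span as a recursive predicate: membership is tested by subtracting a
    multiple of the first vector. *)
Fixpoint kspan M (s : seq M) (m : M) : Prop :=
  if s is x :: s' then exists c, kspan s' (m - iota c *: x) else m = 0.

Lemma fin_dimP M : fin_dim iota M <-> exists s : seq M, forall m, kspan s m.
Proof.
suff spanE (s : seq M) m : kspan s m <->
    exists c : 'I_(size s) -> k, m = \sum_(i < size s) iota (c i) *: s`_i.
  by split=> -[s sP]; exists s => m; apply/spanE; exact: sP.
elim: s m => [|x s IH] m /=.
  split=> [->|[c ->]]; last by rewrite big_ord0.
  by exists (fun=> 0); rewrite big_ord0.
split=> [[a /IH[c cE]]|[c cE]].
  exists (fun i => if unlift ord0 i is Some j then c j else a).
  rewrite big_ord_recl unlift_none /=; under eq_bigr do rewrite liftK.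
  by rewrite -cE addrC subrK.
exists (c ord0); apply/IH; exists (fun i => c (lift ord0 i)).
by rewrite cE big_ord_recl /= addrC addKr.
Qed.

Lemma kspan0 M (s : seq M) : kspan s 0.
Proof. by elim: s => //= x s IH; exists 0; rewrite rmorph0 scale0r subr0. Qed.

Lemma kspanD M (s : seq M) u v : kspan s u -> kspan s v -> kspan s (u + v).
Proof.
elim: s u v => [|x s IH] u v /=; first by move=> -> ->; rewrite addr0.
move=> [c cu] [d dv]; exists (c + d).
by rewrite rmorphD scalerDl opprD addrACA; exact: IH.
Qed.

Lemma kspanZ M (s : seq M) a u : kspan s u -> kspan s (iota a *: u).
Proof.
elim: s u => [|x s IH] u /=; first by move=> ->; rewrite scaler0.
by move=> [c /IH cu]; exists (a * c); rewrite rmorphM -scalerA -scalerBr.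
Qed.

Lemma kspan_sum M (s : seq M) (I : Type) (r : seq I) (F : I -> M) :
  (forall i, kspan s (F i)) -> kspan s (\sum_(i <- r) F i).
Proof.
move=> sF; elim/big_rec: _ => [|i x _]; first exact: kspan0.
exact: kspanD.
Qed.

Lemma kspan_mem M (s : seq M) u : u \in s -> kspan s u.
Proof.
elim: s => //= x s IH; rewrite inE => /orP[/eqP->|/IH su].
  by exists 1; rewrite rmorph1 scale1r subrr; exact: kspan0.
by exists 0; rewrite rmorph0 scale0r subr0.
Qed.

Lemma kspan_trans M (s t : seq M) u :
  {in s, forall x, kspan t x} -> kspan s u -> kspan t u.
Proof.
elim: s u => [|x s IH] u /= st; first by move=> ->; exact: kspan0.
move=> [c cu]; rewrite -(subrK (iota c *: x) u); apply: kspanD.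
  by apply: IH => // y ys; apply: st; rewrite inE ys orbT.
by apply/kspanZ/st; rewrite mem_head.
Qed.

Lemma kspan_map M N (f : {linear M -> N}) (s : seq M) u :
  kspan s u -> kspan (map f s) (f u).
Proof.
elim: s u => [|x s IH] u /=; first by move=> ->; rewrite linear0.
by move=> [c /IH cu]; exists c; move: cu; rewrite linearB linearZ.
Qed.

Lemma fin_dim_surj M N (f : {linear M -> N}) :
  surj f -> fin_dim iota M -> fin_dim iota N.
Proof.
move=> f_surj /fin_dimP[s sP]; apply/fin_dimP; exists (map f s) => y.
by have [x <-] := f_surj y; exact: kspan_map.
Qed.

(** Subspaces of finitely generated spaces are finitely generated: if some
    member of W really involves x, it serves to eliminate x from all the
    others. *)
Lemma kspan_sub M (W : M -> Prop) (s : seq M) :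
  (forall a u v, W u -> W v -> W (u + iota a *: v)) ->
  (forall u, W u -> kspan s u) ->
  exists t : seq M, (forall x, x \in t -> W x) /\ forall u, W u -> kspan t u.
Proof.
elim: s W => [|x s IH] W W_closed Ws; first by exists [::].
have [|u [Wu su]|t [tW tP]] := IH (fun u => W u /\ kspan s u).
- move=> a u v [Wu su] [Wv sv]; split; first exact: W_closed.
  by apply: kspanD => //; exact: kspanZ.
- by [].
have [Ws'|] := pselect (forall u, W u -> kspan s u).
  exists t; split=> [y /tW[]|u Wu] //; apply: tP; split=> //; exact: Ws'.
move=> /existsNP[w /not_implyP[Ww nsw]].
have [c /= cw] := Ws _ Ww.
have c_neq0 : c != 0.
  by apply/eqP => c0; apply: nsw; move: cw; rewrite c0 rmorph0 scale0r subr0.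
exists (w :: t); split=> [y|u Wu].
  by rewrite inE => /orP[/eqP->|/tW[]].
have [d /= du] := Ws _ Wu; exists (d / c); apply: tP; split.
  by rewrite -scaleNr -rmorphN; exact: W_closed.
(* The multiple of w is chosen so that the coefficient of x vanishes. *)
have -> : u - iota (d / c) *: w =
          u - iota d *: x + iota (- (d / c)) *: (w - iota c *: x).
  rewrite scalerBr scalerA -rmorphM mulNr divfK // !rmorphN !scaleNr opprK.
  by rewrite addrACA addNr addr0.
by apply: kspanD => //; exact: kspanZ.
Qed.

Lemma fin_dim_inj K M (i : {linear K -> M}) :
  injective i -> fin_dim iota M -> fin_dim iota K.
Proof.
move=> i_inj /fin_dimP[s sP]; apply/fin_dimP.
have [a u v [x <-] [y <-]|//|t [tW tP]] :=
    @kspan_sub _ (fun u => exists x, i x = u) s.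
  by exists (x + iota a *: y); rewrite linearD linearZ.
have [r rE] : exists r : seq K, map i r = t.
  elim: t tW {tP} => [|x t IH] tW; first by exists [::].
  have [|r <-] := IH; first by move=> y yt; apply: tW; rewrite inE yt orbT.
  have [|y <-] := tW x; first by rewrite mem_head.
  by exists (y :: r).
exists r => x; have : kspan t (i x) by apply: tP; exists x.
rewrite -rE; elim: r x {rE} => [|y r IH] x /=.
  by rewrite -(linear0 i) => /i_inj.
by move=> [c cE]; exists c; apply: IH; rewrite linearB linearZ.
Qed.

Lemma fin_dim_ker M N (f : {linear M -> N}) :
  fin_dim iota M -> fin_dim iota (ker f).
Proof. by apply: fin_dim_inj; exact: ker_val_inj. Qed.

Lemma fin_dim_ffun (I : finType) M :
  fin_dim iota M -> fin_dim iota {ffun I -> M}.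
Proof.
move=> /fin_dimP[s sP]; apply/fin_dimP.
pose d (i : I) (x : M) : {ffun I -> M} := [ffun j => if j == i then x else 0].
have lin_d i : linear (d i).
  move=> a x y; apply/ffunP=> j; rewrite !ffunE.
  by case: ifP => // _; rewrite scaler0 addr0.
exists [seq d i x | i <- enum I, x <- s] => v.
have -> : v = \sum_i d i (v i).
  apply/ffunP=> j; rewrite sum_ffunE (bigD1 j) //= big1 => [|i /negPf ij].
    by rewrite ffunE eqxx addr0.
  by rewrite ffunE eq_sym ij.
apply: kspan_sum => i.
apply: kspan_trans (kspan_map (lin_of (lin_d i)) (sP (v i))).
move=> _ /mapP[x xs ->]; apply: kspan_mem.
by apply/allpairsP; exists (i, x); rewrite mem_enum.
Qed.

Lemma fin_dim_cover M : fin_dim iota M ->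
  exists n (f : {linear {ffun 'I_n -> A^o} -> M}), surj f.
Proof.
move=> [s sP]; exists (size s).
have lin_f : linear (fun v : {ffun 'I_(size s) -> A^o} =>
    \sum_i (v i : A) *: s`_i).
  move=> a u v; rewrite scaler_sumr -big_split; apply: eq_bigr => i _ /=.
  by rewrite !ffunE scalerA -scalerDl.
exists (lin_of lin_f) => m; have [c ->] := sP m.
by exists [ffun i => iota (c i)]; apply: eq_bigr => i _; rewrite ffunE.
Qed.

(** The descent behind induction along a composition series: a generator that
    occurs in m becomes redundant modulo m. *)
Lemma kspan_quotient M N (g : {linear M -> N}) (s : seq M) m :
  (forall x, kspan s x) -> surj g -> m != 0 -> g m = 0 ->
  exists t : seq N, size t = (size s).-1 /\ forall y, kspan t y.
Proof.
move=> sP g_surj m_neq0 gm.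
have [t [tsz tP]] : exists t : seq M, size t = (size s).-1 /\
    forall u, kspan s u -> exists a, kspan t (u - iota a *: m).
  elim: s {sP} (sP m) => [|x s IH] /=; first by move/eqP; rewrite (negPf m_neq0).
  move=> [c cm]; have [c0|c_neq0] := eqVneq c 0.
    move: cm; rewrite c0 rmorph0 scale0r subr0 => sm.
    have [t [tsz tP]] := IH sm; exists (x :: t); split.
      by case: s sm {IH tP} tsz => [/eqP|y s _ /= ->]; first by rewrite (negPf m_neq0).
    move=> u [d /tP[a au]]; exists a, d.
    by rewrite addrAC.
  exists s; split=> // u [d du]; exists (d / c).
  have -> : u - iota (d / c) *: m =
            u - iota d *: x + iota (- (d / c)) *: (m - iota c *: x).
    rewrite scalerBr scalerA -rmorphM mulNr divfK // !rmorphN !scaleNr opprK.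
    by rewrite addrACA addNr addr0.
  by apply: kspanD => //; exact: kspanZ.
exists (map g t); split=> [|y]; first by rewrite size_map.
have [x <-] := g_surj y; have [a /(kspan_map g)] := tP _ (sP x).
by rewrite linearB linearZ /= gm scaler0 subr0.
Qed.

End FiniteDimension.

(** * Traces of endomorphisms *)

Section Traces.
Variables (k : fieldType) (A : pzRingType) (iota : {rmorphism k -> A}).
Variable (tau : {additive A -> k}).
Hypothesis tauC : forall u v, tau (u * v) = tau (v * u).
Implicit Types M N P Q X Y : lmodType A.

(** A finite dual basis: its existence says that P is projective and finitely
    generated, and it makes P a place where traces can be computed. *)
Record dual_basis P := DualBasis {
  db_size : nat;
  db_vec : 'I_db_size -> P;
  db_fun : 'I_db_size -> {linear P -> A^o};
  db_expand : forall x, x = \sum_i (db_fun i x : A) *: db_vec i }.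

Arguments db_vec [P] d i.
Arguments db_fun [P] d i.
Arguments db_expand [P] d x.

(** The Hattori-Stallings trace, composed with tau. *)
Definition ptrace P (B : dual_basis P) (f : P -> P) : k :=
  \sum_i tau (db_fun B i (f (db_vec B i))).

(** Expanding both composites in the two dual bases gives the same double sum,
    up to the order of the products in A, which tau ignores. *)
Lemma ptraceC P Q (B : dual_basis P) (C : dual_basis Q)
    (f : {linear P -> Q}) (g : {linear Q -> P}) :
  ptrace B (g \o f) = ptrace C (f \o g).
Proof.
transitivity (\sum_i \sum_j
    tau ((db_fun C j (f (db_vec B i)) : A) * db_fun B i (g (db_vec C j)))).
  apply: eq_bigr => i _ /=; rewrite {1}(db_expand C (f _)) !linear_sum raddf_sum.
  by apply: eq_bigr => j _; rewrite !linearZ.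
rewrite exchange_big; apply: eq_bigr => j _ /=.
rewrite {2}(db_expand B (g _)) !linear_sum raddf_sum.
by apply: eq_bigr => i _; rewrite !linearZ tauC.
Qed.

Lemma ptraceD P (B : dual_basis P) f g :
  ptrace B (fun x => f x + g x) = ptrace B f + ptrace B g.
Proof.
by rewrite -big_split; apply: eq_bigr => i _; rewrite linearD raddfD.
Qed.

Lemma ptraceB P (B : dual_basis P) f g :
  ptrace B (fun x => f x - g x) = ptrace B f - ptrace B g.
Proof.
rewrite -sumrN -big_split; apply: eq_bigr => i _ /=.
by rewrite linearB raddfB.
Qed.

Lemma eq_ptrace P (B : dual_basis P) f g : f =1 g -> ptrace B f = ptrace B g.
Proof. by move=> fg; apply: eq_bigr => i _; rewrite fg. Qed.

Lemma projective_dual_basis P n (f : {linear {ffun 'I_n -> A^o} -> P}) :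
  projective P -> surj f -> inhabited (dual_basis P).
Proof.
move=> P_proj f_surj; have [s fs] := projective_lift idfun P_proj f_surj.
have lin_c i : linear (fun x => s x i : A^o).
  by move=> a x y; rewrite linearP !ffunE.
pose e i : {ffun 'I_n -> A^o} := [ffun j => if j == i then 1 else 0].
constructor; apply: (@DualBasis P n (f \o e) (fun i => lin_of (lin_c i))) => x /=.
have sE : s x = \sum_i (s x i : A) *: e i.
  apply/ffunP=> j; rewrite sum_ffunE (bigD1 j) //= big1 => [|i /negPf ij].
    by rewrite !ffunE eqxx addr0; exact/esym/mulr1.
  by rewrite !ffunE eq_sym ij scaler0.
rewrite -[LHS]/(idfun x) -fs {1}sE linear_sum.
by apply: eq_bigr => i _; rewrite linearZ.
Qed.

Record fg_resolution M := FgResolution {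
  fg_mod0 : lmodType A; fg_mod1 : lmodType A; fg_mod2 : lmodType A;
  fg_aug : {linear fg_mod0 -> M};
  fg_diff1 : {linear fg_mod1 -> fg_mod0};
  fg_diff2 : {linear fg_mod2 -> fg_mod1};
  fg_proj0 : projective fg_mod0;
  fg_proj1 : projective fg_mod1;
  fg_proj2 : projective fg_mod2;
  fg_basis0 : dual_basis fg_mod0;
  fg_basis1 : dual_basis fg_mod1;
  fg_basis2 : dual_basis fg_mod2;
  fg_surj : surj fg_aug;
  fg_exact0 : forall x, fg_aug x = 0 <-> exists y, fg_diff1 y = x;
  fg_exact1 : forall x, fg_diff1 x = 0 <-> exists y, fg_diff2 y = x;
  fg_inj : injective fg_diff2 }.

(** Finitely generated free covers exist because A is finite-dimensional; the
    second kernel is projective by Schanuel's lemma. *)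
Lemma fg_resolution_exists M :
  fin_dim iota A^o -> fin_dim iota M -> pd_le 2 M ->
  inhabited (fg_resolution M).
Proof.
move=> Afd Mfd pdM.
have free_proj n : projective {ffun 'I_n -> A^o}.
  exact/projective_ffun/projective_regular.
have free_fd n : fin_dim iota {ffun 'I_n -> A^o} by exact: fin_dim_ffun.
have [n [f f_surj]] := fin_dim_cover Mfd.
have [m [g g_surj]] := fin_dim_cover (fin_dim_ker f (free_fd n)).
have [l [h h_surj]] := fin_dim_cover (fin_dim_ker g (free_fd m)).
have pd1 := pd_le_ker (free_proj n) f_surj pdM.
have proj2 : projective (ker g) := pd_le_ker (free_proj m) g_surj pd1.
have [B2] := projective_dual_basis proj2 h_surj.
have idP i : surj (idfun : {linear {ffun 'I_i -> A^o} -> _}).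
  by move=> y; exists y.
have [B0] := projective_dual_basis (free_proj n) (idP n).
have [B1] := projective_dual_basis (free_proj m) (idP m).
constructor; apply: (@FgResolution M _ _ _ f (ker_val f \o g) (ker_val g)
  (free_proj n) (free_proj m) proj2 B0 B1 B2 f_surj _ _ (@ker_val_inj _ _ _ g)).
- move=> x; split=> [/ker_intro[y <-]|[y <-]]; last exact: ker_valK.
  by have [z <-] := g_surj y; exists z.
- move=> x; split=> [/=|[y <-]]; last by rewrite /= ker_valK linear0.
  by rewrite -(linear0 (ker_val f)) => /ker_val_inj/ker_intro.
Qed.

Record lifting M N (R : fg_resolution M) (S : fg_resolution N)
    (f : {linear M -> N}) := Lifting {
  lift0 : {linear fg_mod0 R -> fg_mod0 S};
  lift1 : {linear fg_mod1 R -> fg_mod1 S};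
  lift2 : {linear fg_mod2 R -> fg_mod2 S};
  lift_aug : forall x, fg_aug S (lift0 x) = f (fg_aug R x);
  lift_diff1 : forall x, fg_diff1 S (lift1 x) = lift0 (fg_diff1 R x);
  lift_diff2 : forall x, fg_diff2 S (lift2 x) = lift1 (fg_diff2 R x) }.

Lemma lifting_exists M N (R : fg_resolution M) (S : fg_resolution N)
  (f : {linear M -> N}) : inhabited (lifting R S f).
Proof.
have [f0 f0E] := projective_lift (f \o fg_aug R) (@fg_proj0 _ R) (@fg_surj _ S).
have [||f1 f1E] := projective_lift_exact (d := fg_diff1 S) (e := fg_aug S)
    (f := f0 \o fg_diff1 R) (@fg_proj1 _ R).
- by move=> y /(@fg_exact0 _ S).
- move=> x; rewrite /= f0E /=; have -> : fg_aug R (fg_diff1 R x) = 0.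
    by apply/(@fg_exact0 _ R); exists x.
  by rewrite linear0.
have [||f2 f2E] := projective_lift_exact (d := fg_diff2 S) (e := fg_diff1 S)
    (f := f1 \o fg_diff2 R) (@fg_proj2 _ R).
- by move=> y /(@fg_exact1 _ S).
- move=> x; rewrite /= f1E /=; have -> : fg_diff1 R (fg_diff2 R x) = 0.
    by apply/(@fg_exact1 _ R); exists x.
  by rewrite linear0.
constructor; exact: Lifting f0E f1E f2E.
Qed.

(** The Euler characteristic of the traces of a lift to the resolution. *)
Definition lifting_trace M (R : fg_resolution M) (f : {linear M -> M})
    (F : lifting R R f) : k :=
  ptrace (fg_basis0 R) (lift0 F) - ptrace (fg_basis1 R) (lift1 F)
  + ptrace (fg_basis2 R) (lift2 F).

(** A lift of the zero map is null-homotopic, and in the alternating sum the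
    traces of the homotopy terms d s and s d cancel in pairs by [ptraceC]. *)
Lemma lifting_trace_zero M (R : fg_resolution M) (f : {linear M -> M})
    (F : lifting R R f) :
  (forall x, f x = 0) -> lifting_trace F = 0.
Proof.
move=> f0; case: F => f0' f1 f2 augE d1E d2E; rewrite /lifting_trace /=.
pose d1 := fg_diff1 R; pose d2 := fg_diff2 R.
have d1d2 x : d1 (d2 x) = 0 by apply/(@fg_exact1 _ R); exists x.
have [||s0 s0E] := projective_lift_exact (d := d1) (e := fg_aug R)
    (f := f0') (@fg_proj0 _ R).
- by move=> y /(@fg_exact0 _ R).
- by move=> x; rewrite augE f0.
have lin_g : linear (fun x => f1 x - s0 (d1 x)).
  by move=> a x y; rewrite !linearP scalerDr addrACA.
have [||s1 s1E] := projective_lift_exact (d := d2) (e := d1)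
    (f := lin_of lin_g) (@fg_proj1 _ R).
- by move=> y /(@fg_exact1 _ R).
- by move=> x; rewrite /= linearB d1E s0E subrr.
have f2E x : f2 x = s1 (d2 x).
  by apply: (@fg_inj _ R); rewrite d2E s1E /= d1d2 linear0 subr0.
have f1E x : f1 x = (d2 \o s1) x + (s0 \o d1) x by rewrite /= s1E /= subrK.
rewrite (eq_ptrace _ f1E) ptraceD (eq_ptrace _ f2E).
rewrite (eq_ptrace _ (g := d1 \o s0)); last by move=> x; rewrite -s0E.
rewrite (ptraceC (fg_basis0 R) (fg_basis1 R) s0 d1).
rewrite (ptraceC (fg_basis1 R) (fg_basis2 R) s1 d2).
by rewrite opprD addrCA subrr addr0 addNr.
Qed.

Lemma lifting_trace_unique M (R : fg_resolution M) (f g : {linear M -> M})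
    (F : lifting R R f) (G : lifting R R g) :
  f =1 g -> lifting_trace F = lifting_trace G.
Proof.
move=> fg; apply/eqP; rewrite -subr_eq0; apply/eqP.
have lin_sub X Y (u v : {linear X -> Y}) : linear (fun x => u x - v x).
  by move=> a x y; rewrite !linearP scalerDr addrACA.
have e0 x : fg_aug R (lin_of (lin_sub _ _ (lift0 F) (lift0 G)) x) =
    lin_of (lin_sub _ _ f g) (fg_aug R x) by rewrite /= linearB !lift_aug.
have e1 x : fg_diff1 R (lin_of (lin_sub _ _ (lift1 F) (lift1 G)) x) =
    lin_of (lin_sub _ _ (lift0 F) (lift0 G)) (fg_diff1 R x).
  by rewrite /= linearB !lift_diff1.
have e2 x : fg_diff2 R (lin_of (lin_sub _ _ (lift2 F) (lift2 G)) x) =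
    lin_of (lin_sub _ _ (lift1 F) (lift1 G)) (fg_diff2 R x).
  by rewrite /= linearB !lift_diff2.
have := lifting_trace_zero (Lifting e0 e1 e2).
rewrite /lifting_trace /= !ptraceB => <- => [|x]; last by rewrite /= fg subrr.
rewrite !opprD !opprK [LHS]addrACA; congr (_ + _); exact: addrACA.
Qed.

Lemma lifting_trace_comp M N (R : fg_resolution M) (S : fg_resolution N)
    (f : {linear M -> N}) (g : {linear N -> M}) (F : lifting R R (g \o f))
    (G : lifting S S (f \o g)) :
  lifting_trace F = lifting_trace G.
Proof.
have [u] := lifting_exists R S f; have [v] := lifting_exists S R g.
have vu0 x : fg_aug R ((lift0 v \o lift0 u) x) = (g \o f) (fg_aug R x).
  by rewrite /= !lift_aug.
have vu1 x : fg_diff1 R ((lift1 v \o lift1 u) x) =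
    (lift0 v \o lift0 u) (fg_diff1 R x) by rewrite /= !lift_diff1.
have vu2 x : fg_diff2 R ((lift2 v \o lift2 u) x) =
    (lift1 v \o lift1 u) (fg_diff2 R x) by rewrite /= !lift_diff2.
have uv0 x : fg_aug S ((lift0 u \o lift0 v) x) = (f \o g) (fg_aug S x).
  by rewrite /= !lift_aug.
have uv1 x : fg_diff1 S ((lift1 u \o lift1 v) x) =
    (lift0 u \o lift0 v) (fg_diff1 S x) by rewrite /= !lift_diff1.
have uv2 x : fg_diff2 S ((lift2 u \o lift2 v) x) =
    (lift1 u \o lift1 v) (fg_diff2 S x) by rewrite /= !lift_diff2.
rewrite (lifting_trace_unique F (Lifting vu0 vu1 vu2)) //.
rewrite (lifting_trace_unique G (Lifting uv0 uv1 uv2)) //.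
rewrite /lifting_trace /=.
by congr (_ - _ + _); exact: ptraceC.
Qed.

(** Factor f as M -> im f -> M. The two composites have the same trace, and
    the one on im f is nilpotent of smaller index. *)
Lemma nilpotent_lifting_trace n M (R : fg_resolution M) (f : {linear M -> M})
    (F : lifting R R f) :
  fin_dim iota A^o -> (forall N, fin_dim iota N -> pd_le 2 N) ->
  fin_dim iota M -> (forall x, iter n f x = 0) -> lifting_trace F = 0.
Proof.
move=> Afd pd2; elim: n M R f F => [|n IH] M R f F Mfd f_nil.
  by apply: lifting_trace_zero => x; rewrite [x]f_nil linear0.
have [h [h_surj hE]] := im_corestr f.
have imfd : fin_dim iota (im f) by exact: fin_dim_surj Mfd.
have [S] := fg_resolution_exists Afd imfd (pd2 _ imfd).
have [G] := lifting_exists S S (h \o im_val f).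
have [F'] := lifting_exists R R (im_val f \o h).
rewrite (lifting_trace_unique F F'); last by move=> x; rewrite /= hE.
rewrite (lifting_trace_comp F' G); apply: IH => // x.
have [y <-] := h_surj x.
have -> m : iter m (h \o im_val f) (h y) = h (iter m f y).
  by elim: m => //= m ->; rewrite hE.
by apply: im_val_inj; rewrite hE linear0 -iterS.
Qed.

(** Right multiplication by a is an endomorphism of the module A, which is its
    own resolution, with dual basis 1; so its trace is tau a. *)
Lemma nilpotent_trace n a :
  fin_dim iota A^o -> (forall N, fin_dim iota N -> pd_le 2 N) ->
  a ^+ n = 0 -> tau a = 0.
Proof.
move=> Afd pd2 a_nil.
have lin_a : linear (fun u : A^o => u * a : A^o).
  by move=> b u v; rewrite mulrDl -mulrA.
pose f := lin_of lin_a.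
have one_expand (x : A^o) : x = \sum_(i < 1) ((idfun x : A) *: (1 : A^o)).
  by rewrite big_ord1; exact/esym/mulr1.
pose B1 := @DualBasis A^o 1 (fun=> 1) (fun=> idfun) one_expand.
pose Z : lmodType A := {ffun void -> A^o}.
have Z0 (x : Z) : x = 0 by apply/ffunP => -[].
have Z_proj : projective Z by exact/projective_ffun/projective_regular.
have Z_expand (x : Z) : x = \sum_(i < 0) ((\0 x : A^o) : A) *: (0 : Z).
  by rewrite big_ord0.
pose BZ := @DualBasis Z 0 (fun=> 0) (fun=> \0) Z_expand.
have ex0 (x : A^o) : (idfun : {linear A^o -> A^o}) x = 0 <->
    exists y : Z, (\0 : {linear Z -> A^o}) y = x.
  by split=> [/= ->|[y <-]]; first exists 0.
have ex1 (x : Z) : (\0 : {linear Z -> A^o}) x = 0 <->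
    exists y : Z, (idfun : {linear Z -> Z}) y = x.
  by split=> // _; exists x.
have idsurj : surj (idfun : {linear A^o -> A^o}) by move=> y; exists y.
pose R := @FgResolution A^o _ _ _ idfun \0 idfun (@projective_regular A) Z_proj Z_proj
  B1 BZ BZ idsurj ex0 ex1 (@inj_id Z).
have e1 x : fg_diff1 R ((idfun : {linear Z -> Z}) x) = f (fg_diff1 R x).
  by rewrite linear0.
pose F := @Lifting _ _ R R f f idfun idfun (fun=> erefl) e1 (fun=> erefl).
have : lifting_trace F = 0.
  apply: (@nilpotent_lifting_trace n) => // x.
  have -> : iter n f x = (x : A) * a ^+ n.
    by elim: n {a_nil} => [|n IH] /=; rewrite ?expr0 ?mulr1 // IH -mulrA -exprSr.
  by rewrite a_nil mulr0.
rewrite /lifting_trace /ptrace /= !big_ord1 !big_ord0 subr0 addr0.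
by rewrite mul1r.
Qed.

End Traces.

(** * Quadratic monomial algebras *)

Section RightMultiplication.
Variable A : pzRingType.

Lemma rmul_linear (a : A) : linear (fun u : A^o => u * a : A^o).
Proof. by move=> b u v; rewrite mulrDl -mulrA. Qed.

Definition rmul (a : A) : {linear A^o -> A^o} := lin_of (rmul_linear a).

(** The kernel A b of A -> N is projective, so u |-> u b splits as a map from
    A onto A b. The projection onto the annihilator of b along a splitting is
    right multiplication by an element e. *)
Lemma principal_quotient_pd_le1 (b : A) (N : lmodType A)
    (g : {linear A^o -> N}) :
  surj g -> (forall u, g u = 0 <-> exists v, v * b = u) -> pd_le 1 N ->
  exists e, e * b = 0 /\ forall u, u * b = 0 -> u * e = u.
Proof.
move=> g_surj kerg pdN.
have proj_ker : projective (ker g).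
  by have := pd_le_ker (@projective_regular A) g_surj pdN.
have [u|r rE] := @ker_lift _ _ _ _ g (rmul b); first by apply/kerg; exists u.
have r_surj : surj r.
  move=> y; have /kerg[v vb] := ker_valK y; exists v.
  by apply: ker_val_inj; rewrite rE.
have r0 u : r u = 0 <-> u * b = 0.
  split=> [ru|ub]; first by have := rE u; rewrite ru linear0.
  by apply: ker_val_inj; rewrite rE linear0.
have [s sK] := projective_lift idfun proj_ker r_surj.
exists (1 - s (r 1)); split; first by apply/r0; rewrite linearB sK subrr.
move=> u /r0 ru; rewrite mulrBr mulr1.
have -> : u * s (r 1) = s (r u).
  have -> : r u = r ((u : A) *: (1 : A^o)) by congr (r _); rewrite -[LHS]mulr1.
  by rewrite !linearZ.
by rewrite ru linear0 subr0.
Qed.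

End RightMultiplication.

(** What is used of the quotient of a path algebra by relations R of length
    two: independence says that the left ideals generated by the arrows form a
    direct sum, and [qm_ann] computes the annihilator of an arrow. *)
Record quadratic_monomial (k : fieldType) (A : pzRingType)
    (iota : {rmorphism k -> A}) (V E : finType) (s t : E -> V) (e : V -> A)
    (ar : E -> A) (R : rel E) : Prop := QuadraticMonomial {
  qm_sum1 : \sum_x e x = 1;
  qm_idem : forall x y, e x * e y = if x == y then e x else 0;
  qm_source : forall b, e (s b) * ar b = ar b;
  qm_target : forall b, ar b * e (t b) = ar b;
  qm_decomp : forall u, exists (c : V -> k) (z : E -> A),
    u = \sum_x iota (c x) * e x + \sum_b z b * ar b;
  qm_indep : forall v : E -> A, \sum_b v b * ar b = 0 ->
    forall b, v b * ar b = 0;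
  qm_ann : forall v b, v * ar b = 0 ->
    exists z : E -> A, v * e (s b) = \sum_(a | R a b) z a * ar a;
  qm_compose : forall a b, R a b -> t a = s b;
  qm_zero : forall a b, R a b -> ar a * ar b = 0;
  qm_nilpotent : exists N, forall w : seq E, size w = N ->
    \prod_(b <- w) ar b = 0 }.

Section QuadraticMonomialAlgebras.
Variables (k : fieldType) (A : pzRingType) (iota : {rmorphism k -> A}).
Variables (V E : finType) (s t : E -> V) (e : V -> A) (ar : E -> A).
Variable R : rel E.
Hypothesis qmA : quadratic_monomial iota s t e ar R.

Let ee x : e x * e x = e x.
Proof. by rewrite (qm_idem qmA) eqxx. Qed.

Let ar_e b x : ar b * e x = if t b == x then ar b else 0.
Proof.
rewrite -(qm_target qmA) -mulrA (qm_idem qmA).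
by case: eqP => [->|]; rewrite ?mulr0 // (qm_target qmA).
Qed.

Let e_compl x : e x * (1 - e x) = 0.
Proof. by rewrite mulrBr mulr1 ee subrr. Qed.

Let compl_e x : (1 - e x) * e x = 0.
Proof. by rewrite mulrBl mul1r ee subrr. Qed.

Let compl_compl x : (1 - e x) * (1 - e x) = 1 - e x.
Proof. by rewrite mulrBr mulr1 compl_e subr0. Qed.

Let compl_ar b : (1 - e (s b)) * ar b = 0.
Proof. by rewrite mulrBl mul1r (qm_source qmA) subrr. Qed.

(** Multiply a nonzero vector by arrows as long as the result is nonzero;
    nilpotency stops the process at a vector killed by all arrows, and one of
    its components at the vertices is nonzero. *)
Lemma simple_vector_exists (M : lmodType A) (m0 : M) : m0 != 0 ->
  exists x (m : M), [/\ m != 0, e x *: m = m & forall b, ar b *: m = 0].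
Proof.
move=> m0_neq0; have [N nilN] := qm_nilpotent qmA.
have [m [m_neq0 mar]] : exists m : M, m != 0 /\ forall b, ar b *: m = 0.
  have : forall w : seq E, size w = N -> \prod_(b <- w) ar b *: m0 = 0.
    by move=> w wN; rewrite nilN // scale0r.
  elim: N {nilN} m0 m0_neq0 => [|N IH] m m_neq0 m_nil.
    by have := m_nil [::] erefl; rewrite big_nil scale1r => /eqP; rewrite (negPf m_neq0).
  have [ar0|/existsNP[b /eqP bm]] := pselect (forall b, ar b *: m = 0).
    by exists m.
  apply: (IH _ bm) => w wN; rewrite scalerA -(m_nil (rcons w b)).
    by rewrite -cats1 big_cat big_seq1.
  by rewrite size_rcons wN.
have [[x xm]|all0] := pselect (exists x, e x *: m != 0).
  exists x, (e x *: m); split=> //; first by rewrite scalerA ee.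
  move=> b; rewrite scalerA ar_e; case: eqP => // _; exact: scale0r.
case/negP: m_neq0; rewrite -[m]scale1r -(qm_sum1 qmA) scaler_suml big1 // => x _.
by have [//|xm] := eqVneq (e x *: m) 0; case: all0; exists x.
Qed.

(** The module L is the simple module at x: it is generated by f 1, on which e
    x acts as the identity and the arrows act as zero. *)
Section SimpleModule.
Variables (L : lmodType A) (f : {linear A^o -> L}) (x : V).
Hypotheses (f_surj : surj f) (f1 : f 1 != 0).
Hypotheses (fe : f (e x) = f 1) (far : forall b, f (ar b) = 0).

Let fM (u v : A) : f (u * v) = u *: (f v : L).
Proof. by rewrite -linearZ. Qed.

Let F : lmodType A := ({ffun E -> A^o} * A^o)%type.

Let F_proj : projective F.
Proof.
apply: projective_prod; last exact: projective_regular.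
by apply: projective_ffun; exact: projective_regular.
Qed.

(** The kernel of f is generated by the b e_x, which vanish unless b ends at
    x, and by 1 - e_x. *)
Let cover_linear : linear (fun p : F =>
  \sum_b (p.1 b : A) * (ar b * e x) + (p.2 : A) * (1 - e x) : A^o).
Proof.
move=> a [v w] [v' w'] /=; rewrite scalerDr scaler_sumr addrACA -big_split /=.
congr (_ + _); last by rewrite mulrDl -mulrA.
by apply: eq_bigr => b _; rewrite !ffunE mulrDl -mulrA.
Qed.

Let cover : {linear F -> A^o} := lin_of cover_linear.

Let cover_ker p : f (cover p) = 0.
Proof.
rewrite linearD linear_sum big1 => [|b _]; last first.
  by rewrite ar_e fM; case: eqP => _; rewrite ?far ?linear0 scaler0.
by rewrite fM linearB fe subrr scaler0 addr0.
Qed.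

Let cover_onto u : f u = 0 -> exists p, cover p = u.
Proof.
have [c [z uE]] := qm_decomp qmA u.
have ue : u * e x = iota (c x) * e x + \sum_b z b * (ar b * e x).
  rewrite {1}uE mulrDl !mulr_suml; congr (_ + _); last first.
    by apply: eq_bigr => b _; rewrite mulrA.
  rewrite (bigD1 x) //= big1 => [|y yx]; first by rewrite -mulrA ee addr0.
  by rewrite -mulrA (qm_idem qmA) (negPf yx) mulr0.
move=> fu.
have c0 : c x = 0.
  apply/eqP/negP => /negP cx; case/eqP: f1.
  have : f (u * e x) = 0 by rewrite fM fe -fM mulr1.
  rewrite ue linearD linear_sum big1 => [|b _]; last first.
    by rewrite ar_e fM; case: eqP => _; rewrite ?far ?linear0 scaler0.
  rewrite addr0 fM fe => e0.
  have := congr1 (fun l => iota (c x)^-1 *: l) e0.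
  by rewrite scalerA -rmorphM mulVf // rmorph1 scale1r scaler0.
exists ([ffun b => z b], u) => /=.
under eq_bigr do rewrite ffunE.
by rewrite mulrBr mulr1 ue c0 rmorph0 mul0r add0r addrC subrK.
Qed.

Let cover_eq0 p : cover p = 0 ->
  (forall b, t b = x -> (p.1 b : A) * ar b = 0) /\ (p.2 : A) * (1 - e x) = 0.
Proof.
case: p => v w /= cp.
have w0 : (w : A) * (1 - e x) = 0.
  have := congr1 (fun u : A => u * (1 - e x)) cp.
  rewrite mul0r mulrDl -mulrA compl_compl mulr_suml big1 ?add0r // => b _.
  by rewrite -!mulrA e_compl !mulr0.
move: cp; rewrite w0 addr0 => cp; split=> // b bx.
have /(qm_indep qmA)/(_ b) :
    \sum_b (if t b == x then (v b : A) else 0) * ar b = 0.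
  rewrite -[RHS]cp; apply: eq_bigr => c _; rewrite ar_e.
  by case: eqP; rewrite ?mul0r ?mulr0.
by rewrite bx eqxx.
Qed.

Let coverK_exists : exists phi : {linear F -> ker f},
  surj phi /\ forall p, ker_val f (phi p) = cover p.
Proof.
have [phi phiE] := ker_lift (f := f) (g := cover) cover_ker.
exists phi; split=> // y; have [p pE] := cover_onto (ker_valK y).
by exists p; apply: ker_val_inj; rewrite phiE.
Qed.

(** Without relations, the kernel of the cover of ker f is also the kernel of
    an idempotent endomorphism: v_b b = 0 amounts to v_b e_(s b) = 0. *)
Lemma simple_pd_le1 : (forall a b, ~~ R a b) -> pd_le 1 L.
Proof.
move=> R0; exists A^o, f; split=> //; first exact: projective_regular.
have [phi [phi_surj phiE]] := coverK_exists.
have lin_pi : linear (fun p : F =>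
    ([ffun b => if t b == x then (p.1 b : A) * e (s b) else 0],
     (p.2 : A) * (1 - e x)) : F).
  move=> a [v w] [v' w']; apply: injective_projections => /=.
    apply/ffunP=> b; rewrite !ffunE; case: eqP => _; first by rewrite mulrDl -mulrA.
    by rewrite scaler0 addr0.
  by rewrite mulrDl -mulrA.
apply: (@projective_image _ F _ phi (lin_of lin_pi)) => // -[v w].
  apply: ker_val_inj; rewrite !phiE /=; congr (_ + _); last first.
    by rewrite -mulrA compl_compl.
  apply: eq_bigr => b _; rewrite ffunE ar_e.
  by case: eqP => _; rewrite ?mulr0 // -mulrA (qm_source qmA).
move=> p0; have [|v0 w0] := cover_eq0 (p := (v, w)).
  by rewrite -phiE p0 linear0.
apply: injective_projections => //=; apply/ffunP=> b; rewrite !ffunE.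
case: eqP => // /v0/(qm_ann qmA)[z ->].
by rewrite big_pred0 // => a; exact/negbTE/R0.
Qed.

(** By independence, the elements of the kernel of the cover are those whose
    coordinate at each arrow b ending at x annihilates b, and whose last
    coordinate is killed by 1 - e_x. This kernel is the image of the map r
    below, from a free module with one further coordinate for each pair of
    arrows. The kernel of r is that of an idempotent endomorphism: as
    relations do not overlap, z a = 0 forces z e_(s a) = 0 whenever a starts a
    relation. *)
Lemma simple_pd_le2 : (forall a b c, R a b -> ~~ R c a) -> pd_le 2 L.
Proof.
move=> no_chain; exists A^o, f; split=> //; first exact: projective_regular.
have [phi [phi_surj phiE]] := coverK_exists.
exists F, phi; split=> //.
pose G : lmodType A := (F * {ffun E * E -> A^o})%type.
have G_proj : projective G.
  by apply/projective_prod/projective_ffun => //; exact: projective_regular.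
have lin_r : linear (fun q : G =>
    ([ffun b => if t b == x then (q.1.1 b : A) * (1 - e (s b)) +
        \sum_(a | R a b) (q.2 (a, b) : A) * ar a else q.1.1 b],
     (q.1.2 : A) * e x) : F).
  move=> a [[v w] z] [[v' w'] z']; apply: injective_projections => /=.
    apply/ffunP=> b; rewrite !ffunE; case: eqP => // _.
    rewrite mulrDl -mulrA scalerDr scaler_sumr addrACA -big_split /=.
    congr (_ + _); apply: eq_bigr => c _.
    by rewrite !ffunE mulrDl -mulrA.
  by rewrite mulrDl -mulrA.
have phir q : phi (lin_of lin_r q) = 0.
  case: q => -[v w] z; apply: ker_val_inj; rewrite phiE linear0 /=.
  rewrite -mulrA e_compl mulr0 addr0 big1 // => b _; rewrite ffunE ar_e.
  case: eqP => _; last by rewrite mulr0.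
  rewrite mulrDl -mulrA compl_ar mulr0 add0r mulr_suml big1 // => a Rab.
  by rewrite -mulrA (qm_zero qmA) // mulr0.
have [r rE] := ker_lift phir.
have lin_pi : linear (fun q : G =>
    (([ffun b => if t b == x then (q.1.1 b : A) * (1 - e (s b)) else q.1.1 b],
      (q.1.2 : A) * e x) : F,
     [ffun c => if R c.1 c.2 && (t c.2 == x) then (q.2 c : A) * e (s c.1)
                else 0]) : G).
  move=> a [[v w] z] [[v' w'] z'].
  apply: injective_projections; [apply: injective_projections|] => /=.
  - by apply/ffunP=> b; rewrite !ffunE; case: eqP => // _; rewrite mulrDl -mulrA.
  - by rewrite mulrDl -mulrA.
  - apply/ffunP=> b; rewrite !ffunE; case: ifP => _.
      by rewrite mulrDl -mulrA.
    by rewrite scaler0 addr0.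
apply: (@projective_image _ G _ r (lin_of lin_pi)) => //.
- move=> y; have [|v0 w0] := cover_eq0 (p := ker_val phi y).
    by rewrite -phiE ker_valK linear0.
  case yE: (ker_val phi y) v0 w0 => [v w] /= v0 w0.
  have /choice[z zE] b : exists z : E -> A, t b = x ->
      (v b : A) * e (s b) = \sum_(a | R a b) z a * ar a.
    have [/v0/(qm_ann qmA)[z zE]|bx] := eqVneq (t b) x; first by exists z.
    by exists (fun=> 0) => /eqP; rewrite (negPf bx).
  exists ((v, w), [ffun c => z c.2 c.1]); apply: ker_val_inj.
  rewrite rE yE /=; apply: injective_projections => /=.
    apply/ffunP=> b; rewrite ffunE; case: eqP => // bx.
    under eq_bigr do rewrite ffunE /=.
    by rewrite -zE // mulrBr mulr1 subrK.
  by move/eqP: w0; rewrite mulrBr mulr1 subr_eq0 => /eqP.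
- move=> -[[v w] z]; apply: ker_val_inj; rewrite !rE.
  apply: injective_projections => /=; last by rewrite -mulrA ee.
  apply/ffunP=> b; rewrite !ffunE; case: eqP => // bx.
  rewrite -mulrA compl_compl; congr (_ + _); apply: eq_bigr => a Rab.
  by rewrite ffunE /= Rab bx eqxx /= -mulrA (qm_source qmA).
- move=> -[[v w] z] rq.
  have : lin_of lin_r ((v, w), z) = 0 by rewrite -rE rq linear0.
  move=> /= [/ffunP v0 w0].
  have z0 b : t b = x -> \sum_(a | R a b) (z (a, b) : A) * ar a = 0.
    move=> bx; have := v0 b; rewrite !ffunE bx eqxx.
    move=> /(congr1 (fun u : A => u * e (s b))).
    rewrite mulrDl mul0r -mulrA compl_e mulr0 add0r mulr_suml => zs.
    rewrite -[RHS]zs. apply: eq_bigr => a /(qm_compose qmA) ab.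
    by rewrite -mulrA ar_e ab eqxx.
  apply: injective_projections => /=; [apply: injective_projections => //=|];
    apply/ffunP.
    move=> b; have := v0 b; rewrite !ffunE; case: eqP => // bx.
    by rewrite z0 // addr0.
  move=> [a b]; rewrite !ffunE /=; case: ifP => // /andP[Rab /eqP bx].
  have : (z (a, b) : A) * ar a = 0.
    have /(qm_indep qmA)/(_ a) :
        \sum_a (if R a b then (z (a, b) : A) else 0) * ar a = 0.
      rewrite -[RHS](z0 b bx) [RHS]big_mkcond /=; apply: eq_bigr => c _.
      by case: ifP; rewrite ?mul0r.
    by rewrite Rab.
  move=> /(qm_ann qmA)[z' ->]; rewrite big_pred0 // => c.
  exact/negbTE/(no_chain a b).
Qed.

End SimpleModule.

(** Induction along a composition series, peeling off the simple submodule
    generated by a vector given by [simple_vector_exists]. *)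
Lemma fin_dim_pd_le n :
  (forall (L : lmodType A) (f : {linear A^o -> L}) x, surj f -> f 1 != 0 ->
     f (e x) = f 1 -> (forall b, f (ar b) = 0) -> pd_le n L) ->
  forall M : lmodType A, fin_dim iota M -> pd_le n M.
Proof.
move=> simple_pd M /fin_dimP[r rP].
have [N rN] := ubnP (size r); elim: N M r rP rN => // N IH M r rP rN.
have [all0|/existsNP[m0 /eqP m0_neq0]] := pselect (forall m : M, m = 0).
  apply: projective_pd_le; apply: (@projective_retract _ A^o _ \0 \0).
    exact: projective_regular.
  by move=> m; rewrite [m]all0 linear0.
have [x [m [m_neq0 em arm]]] := simple_vector_exists m0_neq0.
have lin_mu : linear (fun u : A^o => (u : A) *: m).
  by move=> a u v; rewrite scalerDl scalerA.
pose mu := lin_of lin_mu.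
have [h [h_surj hE]] := im_corestr mu.
have [Q [g [g_surj kerg]]] := quot_mod_exists (Submodule (im_submod mu)).
have imE y : g y = 0 <-> exists l, im_val mu l = y.
  split=> [/kerg/asboolP[u <-]|[l <-]]; first by exists (h u).
  by apply/kerg/asboolP; have [u <-] := h_surj l; exists u; rewrite hE.
apply: (pd_le_ext (@im_val_inj _ _ _ mu) g_surj imE).
  apply: (simple_pd _ h x) => //.
  - apply: contra_neq m_neq0 => h1.
    by rewrite -[m]scale1r -[LHS]hE h1 linear0.
  - by apply: im_val_inj; rewrite !hE /= em scale1r.
  - by move=> b; apply: im_val_inj; rewrite hE linear0 /= arm.
have [|q [qr qP]] := kspan_quotient rP g_surj m_neq0.
  by apply/imE; exists (h 1); rewrite hE /= scale1r.
apply: (IH _ q) => //; rewrite qr.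
case: r rP rN {qr} => [rP _|u r _] //=.
by have /= mz := rP m; rewrite mz eqxx in m_neq0.
Qed.

Lemma monomial_pd_le1 : (forall a b, ~~ R a b) ->
  forall M : lmodType A, fin_dim iota M -> pd_le 1 M.
Proof.
by move=> R0; apply: fin_dim_pd_le => L f x *; exact: (simple_pd_le1 (x := x)).
Qed.

Lemma monomial_pd_le2 : (forall a b c, R a b -> ~~ R c a) ->
  forall M : lmodType A, fin_dim iota M -> pd_le 2 M.
Proof.
by move=> nc; apply: fin_dim_pd_le => L f x *; exact: (simple_pd_le2 (x := x)).
Qed.

End QuadraticMonomialAlgebras.

(** * Coefficients in the path algebra *)

Section PathCoefficients.
Variables (k : fieldType) (Q : quiver).
Local Notation kQ := (path_alg k Q).
Local Notation word := (vertex Q * seq (arrow Q))%type.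
Implicit Types (u v : kQ) (p q : qpath Q) (x y : vertex Q).
Implicit Types (a b c : arrow Q) (s : seq (arrow Q)) (w : word).

Definition endpoint x s : vertex Q := last x (map (@target Q) s).

(** The coefficient at a word, with value 0 at words that are not paths, so
    that words can be cut and concatenated freely. *)
Definition cf (w : word) (u : kQ) : k :=
  if insub w is Some p then u@_(p : qpath Q) else 0.

Lemma cf0 w : cf w 0 = 0.
Proof. by rewrite /cf; case: insub => // p; rewrite mcoeff0. Qed.

Lemma cfD w u v : cf w (u + v) = cf w u + cf w v.
Proof. by rewrite /cf; case: insub => [p|]; rewrite ?mcoeffD ?addr0. Qed.

Lemma cfZ w (l : k) u : cf w (l *: u) = l * cf w u.
Proof. by rewrite /cf; case: insub => [p|]; rewrite ?mcoeffZ ?mulr0. Qed.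

Lemma cfB w u v : cf w (u - v) = cf w u - cf w v.
Proof. by rewrite -scaleN1r cfD cfZ mulN1r. Qed.

Lemma cf_sum w (I : Type) (r : seq I) (P : pred I) (F : I -> kQ) :
  cf w (\sum_(i <- r | P i) F i) = \sum_(i <- r | P i) cf w (F i).
Proof. exact: (big_morph (cf w) (cfD w) (cf0 w)). Qed.

Lemma cf_path w p : cf w (path_elt k p) = (val p == w)%:R.
Proof.
rewrite /cf path_elt.unlock; case: insubP => [q _ <-|]; first by rewrite mcoeffU.
by case: eqP => // <-; rewrite (valP p).
Qed.

Lemma cf_val p u : cf (val p) u = u@_p.
Proof. by rewrite /cf valK. Qed.

Lemma cf_noncomposable x s u : ~~ composable x s -> cf (x, s) u = 0.
Proof. by move=> ns; rewrite /cf insubN. Qed.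

Lemma cf_eq0 u : (forall x s, cf (x, s) u = 0) -> u = 0.
Proof.
move=> u0; apply/malgP => p; rewrite mcoeff0 -cf_val.
by case: (val p) => x s; exact: u0.
Qed.

Lemma path_elt_mul p q : path_elt k p * path_elt k q = path_prod k p q.
Proof. exact: pa_mulUU. Qed.

Lemma cf_path_mul p q x s :
  cf (x, s) (path_elt k p * path_elt k q) =
  \sum_(i < (size s).+1)
    cf (x, take i s) (path_elt k p) *
    cf (endpoint x (take i s), drop i s) (path_elt k q).
Proof.
rewrite path_elt_mul.
have zero i : size (path_arrows p) != i -> (i <= size s)%N ->
    cf (x, take i s) (path_elt k p) = 0.
  move=> pi le_is; rewrite cf_path; case: eqP => // e; case/eqP: pi.
  by rewrite /path_arrows e size_takel.
have [lt_sp|le_ps] := ltnP (size s) (size (path_arrows p)).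
  rewrite big1 => [|i _]; last first.
    have le_is : (i <= size s)%N by rewrite -ltnS.
    by rewrite zero ?mul0r // neq_ltn (leq_ltn_trans le_is lt_sp) orbT.
  rewrite /path_prod; case epq: (path_cat p q) => [r|]; last exact: cf0.
  rewrite cf_path; case: eqP => // e; move: epq; rewrite /path_cat.
  case: eqP => // _; case: insubP => // r' _ r'E [rr'].
  move: lt_sp; have [_ <-] : (path_source p, path_arrows p ++ path_arrows q) = (x, s).
    by rewrite -r'E rr' e.
  by rewrite size_cat ltnNge leq_addr.
rewrite (bigD1 (inord (size (path_arrows p)))) //= big1 => [|i]; last first.
  rewrite -val_eqE /= inordK ?ltnS // eq_sym => ip.
  by rewrite zero ?mul0r // -ltnS.
rewrite inordK ?ltnS // addr0 !cf_path.
have -> : val p = (path_source p, path_arrows p) by case: p {zero le_ps} => -[].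
have -> : val q = (path_source q, path_arrows q) by case: q {zero le_ps} => -[].
rewrite !xpair_eqE -natrM mulnb -{1}(cat_take_drop (size (path_arrows p)) s).
set n := size _; have [eqs|nqs] := eqVneq (path_target p) (path_source q).
  have := path_cat_val eqs; rewrite /path_prod; case: (path_cat p q) => //= r [rE].
  rewrite cf_path (rE : val r = _) xpair_eqE eqseq_cat ?size_takel //.
  case: eqP => //= px; case: eqP => //= pt.
  suff -> : path_source q == endpoint x (take n s) by [].
  by rewrite -eqs /path_target px pt.
rewrite /path_prod /path_cat (negPf nqs) cf0.
case: eqP => //= px; case: eqP => //= pt; case: eqP => //= qe.
by case/eqP: nqs; rewrite qe /path_target px pt.
Qed.

(** The product as a convolution over all ways to cut a path in two. *)
Lemma cfM u v x s :
  cf (x, s) (u * v) =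
  \sum_(i < (size s).+1)
    cf (x, take i s) u * cf (endpoint x (take i s), drop i s) v.
Proof.
elim/pa_ind: u => [|u u' IH IH'|l p].
- by rewrite mul0r cf0 big1 // => i _; rewrite cf0 mul0r.
- rewrite mulrDl cfD IH IH' -big_split; apply: eq_bigr => i _ /=.
  by rewrite cfD mulrDl.
have -> : (l *: path_elt k p) * v = l *: (path_elt k p * v).
  exact: esym (pa_scaleAl _ _ _).
rewrite cfZ; under eq_bigr do rewrite cfZ -mulrA.
rewrite -mulr_sumr; congr (_ * _).
elim/pa_ind: v => [|v v' IH IH'|m q].
- by rewrite mulr0 cf0 big1 // => i _; rewrite cf0 mulr0.
- rewrite mulrDr cfD IH IH' -big_split; apply: eq_bigr => i _ /=.
  by rewrite cfD mulrDr.
have -> : path_elt k p * (m *: path_elt k q) = m *: (path_elt k p * path_elt k q).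
  exact: esym (pa_scaleAr _ _ _).
rewrite cfZ cf_path_mul mulr_sumr.
by apply: eq_bigr => i _; rewrite cfZ mulrCA.
Qed.

Lemma cf_trivial y x s :
  cf (x, s) (path_elt k (trivial_path y)) = ((x == y) && (s == [::]))%:R.
Proof. by rewrite cf_path /= eq_sym xpair_eqE. Qed.

Lemma cf_arrow b x s :
  cf (x, s) (arrow_elt k b) = ((x == source b) && (s == [:: b]))%:R.
Proof. by rewrite cf_path /= eq_sym xpair_eqE. Qed.

Lemma cf_mul_trivial u y x s :
  cf (x, s) (u * path_elt k (trivial_path y)) =
  if endpoint x s == y then cf (x, s) u else 0.
Proof.
rewrite cfM big_ord_recr /= big1 => [|i _]; last first.
  rewrite cf_trivial -size_eq0 size_drop subn_eq0 leqNgt ltn_ord andbF.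
  by rewrite mulr0.
rewrite take_size drop_size cf_trivial eqxx andbT add0r.
by case: eqP; rewrite ?mulr1 ?mulr0.
Qed.

Lemma cf_mul_arrow0 u b x : cf (x, [::]) (u * arrow_elt k b) = 0.
Proof. by rewrite cfM big_ord1 /= cf_arrow andbF mulr0. Qed.

Lemma cf_mul_arrow u b x s c :
  cf (x, rcons s c) (u * arrow_elt k b) =
  if (c == b) && (endpoint x s == source b) then cf (x, s) u else 0.
Proof.
rewrite cfM size_rcons big_ord_recr /= drop_oversize ?size_rcons //.
rewrite cf_arrow andbF mulr0 addr0 big_ord_recr /= big1 => [|i _]; last first.
  rewrite cf_arrow; case: eqP => //= _; last by rewrite mulr0.
  case: eqP => [e|]; last by rewrite mulr0.
  have := congr1 size e; rewrite size_drop size_rcons /= => si.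
  by have := ltn_ord i; rewrite -subn_gt0 -ltnS -subSn ?si // ltnW.
rewrite -cats1 take_size_cat // drop_size_cat // cf_arrow eqseq_cons eqxx andbT.
by rewrite andbC add0r; case: andP; rewrite ?mulr1 ?mulr0.
Qed.

(** The elements in which only paths of length at least n occur; this is the
    n-th power of the arrow ideal by [ideal_exp_arrow_ideal]. *)
Definition order_ge n : set kQ :=
  [set u | forall x s, (size s < n)%N -> cf (x, s) u = 0].

Lemma order_geM m n u v :
  order_ge m u -> order_ge n v -> order_ge (m + n) (u * v).
Proof.
move=> um vn x s lt_s; rewrite cfM big1 // => i _.
have le_is : (i <= size s)%N by rewrite -ltnS.
have [lt_im|le_mi] := ltnP i m; first by rewrite um ?mul0r // size_takel.
rewrite vn ?mulr0 // size_drop ltn_subLR //.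
by apply: leq_trans lt_s _; rewrite leq_add2r.
Qed.

Lemma order_ge_ideal n : is_ideal (order_ge n).
Proof.
split=> [x s _|u v un vn x s lt_s|u v vn|u v un]; first exact: cf0.
- by rewrite cfD un // vn // addr0.
- by apply: (@order_geM 0 n) => // x s.
- by rewrite -[n]addn0; apply: order_geM => // x s.
Qed.

End PathCoefficients.

(** * Powers of the arrow ideal *)

Section IdealPowers.
Variable R : pzRingType.

Lemma gen_ideal_is_ideal (S : set R) : is_ideal (gen_ideal S).
Proof.
split=> [J _|x y Sx Sy J SJ|a x Sx J SJ|a x Sx J SJ]; have [J0 JD JMl JMr] := idealP J.
- exact: J0.
- by apply: JD; [exact: Sx | exact: Sy].
- by apply: JMl; exact: Sx.
- by apply: JMr; exact: Sx.
Qed.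

Lemma ideal_mul_is_ideal (I J : set R) :
  is_ideal I -> is_ideal J -> is_ideal (ideal_mul I J).
Proof.
move=> [_ _ IMl _] [_ _ _ JMr]; split.
- by exists [::]; split=> //; rewrite big_nil.
- move=> _ _ [r [rP ->]] [t [tP ->]]; exists (r ++ t); split.
    by move=> p; rewrite mem_cat => /orP[/rP|/tP].
  by rewrite big_cat.
- move=> a _ [r [rP ->]]; exists [seq (a * p.1, p.2) | p <- r]; split.
    by move=> _ /mapP[p /rP[p1 p2] ->]; split=> //; exact: IMl.
  by rewrite big_map mulr_sumr; apply: eq_bigr => p _; rewrite mulrA.
- move=> a _ [r [rP ->]]; exists [seq (p.1, p.2 * a) | p <- r]; split.
    by move=> _ /mapP[p /rP[p1 p2] ->]; split=> //; exact: JMr.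
  by rewrite big_map mulr_suml; apply: eq_bigr => p _; rewrite mulrA.
Qed.

Lemma ideal_exp_is_ideal (I : set R) n : is_ideal I -> is_ideal (ideal_exp I n).
Proof. by move=> I_id; elim: n => //= n; exact: ideal_mul_is_ideal. Qed.

End IdealPowers.

Section ArrowIdeal.
Variables (k : fieldType) (Q : quiver).
Local Notation kQ := (path_alg k Q).
Implicit Types (u v : kQ) (p q : qpath Q) (x y : vertex Q) (a b : arrow Q).

Lemma pa_scale_mul (l : k) u : l *: u = pa_scalar Q l * u.
Proof. by rewrite -[in LHS](mul1r u); exact: (pa_scaleAl l 1 u). Qed.

Lemma ideal_scale (I : set kQ) (l : k) u : is_ideal I -> I u -> I (l *: u).
Proof. by move=> [_ _ IMl _] Iu; rewrite pa_scale_mul; exact: IMl. Qed.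

Lemma pa_expand u : u = \sum_(p <- msupp u) u@_p *: path_elt k p.
Proof.
rewrite {1}[u]monalgE; apply: eq_bigr => p _.
by rewrite path_elt.unlock; exact: malgU_scale.
Qed.

Lemma path_elt_cons x b s (p : qpath Q) : val p = (x, b :: s) ->
  exists q, val q = (target b, s) /\ path_elt k p = arrow_elt k b * path_elt k q.
Proof.
move=> pE; have := valP p; rewrite pE /= => /andP[/eqP bx bs].
exists (@QPath Q (target b, s) bs); split=> //.
rewrite path_elt_mul /path_prod.
have /path_cat_val : path_target (arrow_path b) =
  path_source (@QPath Q (target b, s) bs) by [].
case: path_cat => //= r [rE]; congr path_elt; apply: val_inj.
by rewrite pE -[RHS]/(path_val r) rE /path_source /= bx.
Qed.

Lemma path_elt_rcons x b s (p : qpath Q) : val p = (x, rcons s b) ->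
  exists q, val q = (x, s) /\ path_elt k p = path_elt k q * arrow_elt k b.
Proof.
move=> pE; have := valP p; rewrite pE /= -cats1 composable_cat.
move=> /andP[xs]; rewrite /= andbT => /eqP bs.
exists (@QPath Q (x, s) xs); split=> //.
rewrite path_elt_mul /path_prod.
have /path_cat_val : path_target (@QPath Q (x, s) xs) =
  path_source (arrow_path b) by exact: esym.
case: path_cat => //= r [rE]; congr path_elt; apply: val_inj.
by rewrite pE -[RHS]/(path_val r) rE /path_source /path_arrows /= cats1.
Qed.

Lemma arrow_ideal_is_ideal : is_ideal (arrow_ideal k Q).
Proof. exact: gen_ideal_is_ideal. Qed.

Lemma path_ideal_exp n x s (p : qpath Q) : val p = (x, s) -> (n <= size s)%N ->
  ideal_exp (arrow_ideal k Q) n (path_elt k p).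
Proof.
elim: n x s p => [//|n IH] x [//|b s] p pE lt_ns.
have [q [qE ->]] := path_elt_cons pE.
exists [:: (arrow_elt k b, path_elt k q)]; split; last by rewrite big_seq1.
move=> _ /[!inE] /eqP-> /=; split; last exact: IH qE _.
by move=> J; apply; exists b.
Qed.

Lemma ideal_exp_arrow_ideal n :
  ideal_exp (arrow_ideal k Q) n = order_ge n.
Proof.
apply/seteqP; split=> [|u un].
  elim: n => [u _ x s //|n IH _ [r [rP ->]] x s lt_s].
  rewrite cf_sum big_seq big1 // => p /rP[p1 /IH p2].
  suff p1_order : order_ge 1 p.1 by exact: (order_geM p1_order p2).
  apply: (p1 (Ideal (@order_ge_ideal k Q 1))) => _ [b _ <-] y [|//] _.
  by rewrite cf_arrow andbF.
have exp_id := ideal_exp_is_ideal n arrow_ideal_is_ideal.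
have [I0 ID _ _] := exp_id; rewrite (pa_expand u).
elim/big_ind: _ => // p _; have [->|up] := eqVneq (u@_p) 0.
  by rewrite scale0r.
apply: ideal_scale => //; case pE: (val p) => [x s].
apply: (path_ideal_exp pE); rewrite leqNgt; apply: contraNN up => lt_sn.
by rewrite -cf_val pE un.
Qed.

(** Sort the paths by their last arrow. *)
Lemma pa_decomp u : exists (c : vertex Q -> k) (z : arrow Q -> kQ),
  u = \sum_x pa_scalar Q (c x) * path_elt k (trivial_path x)
      + \sum_b z b * arrow_elt k b.
Proof.
elim/pa_ind: u => [|u v [c [z ->]] [d [w ->]]|l p].
- exists (fun=> 0), (fun=> 0).
  by rewrite !big1 ?addr0 // => [b _|x _]; rewrite ?rmorph0 mul0r.
- exists (fun x => c x + d x), (fun b => z b + w b).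
  rewrite [LHS]addrACA; congr (_ + _); rewrite -[LHS]big_split.
    by apply: eq_bigr => x _; rewrite rmorphD -[LHS]mulrDl.
  by apply: eq_bigr => b _; rewrite -[LHS]mulrDl.
rewrite pa_scale_mul.
case pE: (val p) => [x s]; case: (lastP s) pE => [|{}s b] pE.
  exists (fun y => if y == x then l else 0), (fun=> 0).
  rewrite [X in _ + X]big1 => [|b _]; last exact: mul0r.
  rewrite (bigD1 x) //= eqxx big1 => [|y /negPf->].
    rewrite !addr0; congr (_ * path_elt k _).
    by apply: val_inj; rewrite pE.
  by rewrite rmorph0; exact: mul0r.
have [q [_ ->]] := path_elt_rcons pE.
exists (fun=> 0), (fun a => if a == b then pa_scalar Q l * path_elt k q else 0).
rewrite big1 => [|y _]; last by rewrite rmorph0; exact: mul0r.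
rewrite (bigD1 b) //= eqxx big1 => [|y /negPf->]; last exact: mul0r.
by rewrite add0r addr0 -[RHS]mulrA.
Qed.

(** The paths of length less than N span the quotient, and there are finitely
    many. *)
Lemma fin_dim_quotient (I : ideal kQ) N :
  order_ge N `<=` I -> fin_dim (quot_scalar I) (quot_ring I)^o.
Proof.
move=> NI; apply/fin_dimP.
pose words : seq (seq (arrow Q)) :=
  [seq tval t | i <- iota 0 N, t <- enum {: i.-tuple (arrow Q)}].
pose paths : seq (qpath Q) :=
  pmap insub [seq (x, s) | x <- enum (vertex Q), s <- words].
exists [seq (quot_pi I (path_elt k p) : (quot_ring I)^o) | p <- paths].
set r := map _ _; suff spanU u : kspan (quot_scalar I) r (quot_pi I u) by elim/quot_ind.
rewrite {1}(pa_expand u) raddf_sum; apply: kspan_sum => p.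
suff: kspan (quot_scalar I) r (quot_pi I (u@_p *: path_elt k p)) by [].
have -> : quot_pi I (u@_p *: path_elt k p) =
    quot_scalar I u@_p * quot_pi I (path_elt k p).
  by rewrite pa_scale_mul rmorphM.
apply: kspanZ; case pE: (val p) => [x s].
have [lt_sN|le_Ns] := ltnP (size s) N; last first.
  suff -> : quot_pi I (path_elt k p) = 0 by exact: kspan0.
  rewrite -(raddf0 (quot_pi I)); apply/quot_eqP; rewrite subr0; apply: NI.
  by rewrite -ideal_exp_arrow_ideal; exact: path_ideal_exp pE _.
apply: kspan_mem; apply: map_f; rewrite mem_pmap_sub pE.
apply/allpairsP; exists (x, s); split; rewrite ?mem_enum //=.
apply/allpairsPdep; exists (size s), (in_tuple s).
by rewrite mem_iota mem_enum.
Qed.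

End ArrowIdeal.

(** * Quotients by quadratic monomial ideals *)

Section QuadraticMonomialQuotient.
Variables (k : fieldType) (Q : quiver) (R : rel (arrow Q)).
Local Notation kQ := (path_alg k Q).
Implicit Types (u v : kQ) (x y : vertex Q) (a b c : arrow Q).
Implicit Types (s : seq (arrow Q)).

Definition avoids s : bool := sorted (fun a b => ~~ R a b) s.

(** The span of the paths that contain a relation. *)
Definition monomial_set : set kQ :=
  [set u | forall x s, avoids s -> cf (x, s) u = 0].

Lemma monomial_is_ideal : is_ideal monomial_set.
Proof.
split=> [x s _|u v Iu Iv x s av|u v Iv x s av|u v Iu x s av].
- exact: cf0.
- by rewrite cfD Iu // Iv // addr0.
- rewrite cfM big1 // => i _; rewrite Iv ?mulr0 //.
  by move: av; rewrite /avoids -{1}(cat_take_drop i s) => /cat_sorted2[].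
- rewrite cfM big1 // => i _; rewrite Iu ?mul0r //.
  by move: av; rewrite /avoids -{1}(cat_take_drop i s) => /cat_sorted2[].
Qed.

Definition monomial_ideal : ideal kQ := Ideal monomial_is_ideal.

Lemma order_ge_monomial N :
  (forall x s, composable x s -> avoids s -> (size s < N)%N) ->
  order_ge N `<=` monomial_ideal.
Proof.
move=> avN u uN x s av; have [xs|nxs] := boolP (composable x s).
  by rewrite uN // (avN x).
exact: cf_noncomposable.
Qed.

Lemma monomial_order_ge2 : monomial_ideal `<=` order_ge 2.
Proof. by move=> u Iu x [|a [|//]] _; exact: Iu. Qed.

Local Notation A := (quot_ring monomial_ideal).
Local Notation pi := (quot_pi monomial_ideal).
Local Notation e x := (pi (path_elt k (trivial_path x))).
Local Notation ar b := (pi (arrow_elt k b)).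

Lemma pi_eq0 u : pi u = 0 <-> monomial_set u.
Proof.
have -> : (0 : A) = pi 0 by rewrite raddf0.
by rewrite quot_eqP subr0.
Qed.

Lemma pi_surj (z : A) : exists u, z = pi u.
Proof. by elim/quot_ind: z => u; exists u. Qed.

Lemma avoids_rcons2 s a b : avoids (rcons s a) -> ~~ R a b ->
  avoids (rcons (rcons s a) b).
Proof.
rewrite /avoids; case: s => [|c s] /=; first by move=> _ ->.
by rewrite [path _ _ (rcons (rcons _ _) _)]rcons_path last_rcons => -> ->.
Qed.

Lemma arrow_mul_eq0 a b : R a b -> ar a * ar b = 0.
Proof.
move=> Rab; rewrite -rmorphM; apply/pi_eq0 => x s.
case: (lastP s) => [|{}s c] av; first exact: cf_mul_arrow0.
rewrite cf_mul_arrow; case: eqP => //= cb; case: eqP => // _.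
rewrite cf_arrow; case: eqP => //= _; case: eqP => // sa.
by move: av; rewrite sa cb /avoids /= Rab.
Qed.

(** All properties are read off coefficients at the words that avoid R. For
    the annihilator of b, let u be a representative with u b in the ideal: a
    path of u that avoids R and ends at the source of b must end with an arrow
    a with R a b, since otherwise appending b would avoid R too. *)
Lemma monomial_quotient N :
  (forall a b, R a b -> target a = source b) ->
  (forall x s, composable x s -> avoids s -> (size s < N)%N) ->
  quadratic_monomial (quot_scalar monomial_ideal) (@source Q) (@target Q)
    (fun x => e x) (fun b => ar b) R.
Proof.
move=> R_comp avN; split.
- rewrite -rmorph_sum -(rmorph1 pi); congr (pi _).
  by rewrite -[RHS]/(pa_one k Q) pa_one.unlock.
- move=> x y; rewrite -rmorphM path_elt_mul /path_prod path_cat1p.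
  by case: eqP => [->|] //; rewrite rmorph0.
- move=> b; rewrite -rmorphM path_elt_mul /path_prod path_cat1p.
  by rewrite eqxx.
- move=> b; rewrite -rmorphM path_elt_mul /path_prod path_catp1.
  by rewrite eqxx.
- move=> z; have [u ->] := pi_surj z; have [c [w ->]] := pa_decomp u.
  exists c, (fun b => pi (w b)); rewrite rmorphD !rmorph_sum.
  by congr (_ + _); apply: eq_bigr => i _; rewrite rmorphM.
- move=> v; have /choice[w wE] b := pi_surj (v b).
  under eq_bigr do rewrite wE -rmorphM.
  rewrite -rmorph_sum => /pi_eq0 Iw b; rewrite wE -rmorphM; apply/pi_eq0.
  move=> x s; case: (lastP s) => [|{}s c] av; first exact: cf_mul_arrow0.
  rewrite cf_mul_arrow; case: eqP => //= cb; rewrite -cb.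
  have := Iw x _ av; rewrite cf_sum (bigD1 c) //= big1 => [|a ac].
    by rewrite addr0 cf_mul_arrow eqxx.
  by rewrite cf_mul_arrow eq_sym (negPf ac).
- move=> z b; have [u ->] := pi_surj z; rewrite -rmorphM => /pi_eq0 ub.
  have [c [w uE]] := pa_decomp u; exists (fun a => pi (w a)).
  under eq_bigr do rewrite -rmorphM.
  rewrite -rmorphM -rmorph_sum; apply/quot_eqP => x s.
  rewrite cfB cf_mul_trivial cf_sum.
  case: (lastP s) => [|{}s a] av.
    rewrite big1 ?subr0 => [|a _]; last exact: cf_mul_arrow0.
    case: eqP => // xb; have := ub x (rcons [::] b) isT.
    by rewrite cf_mul_arrow eqxx xb eqxx.
  have cfu : cf (x, rcons s a) u = cf (x, rcons s a) (w a * arrow_elt k a).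
    rewrite uE cfD !cf_sum big1 ?add0r => [|y _]; last first.
      rewrite -[X in cf _ X]pa_scale_mul cfZ cf_trivial -size_eq0 size_rcons.
      by rewrite andbF mulr0.
    rewrite (bigD1 a) //= big1 ?addr0 // => a' aa'.
    by rewrite cf_mul_arrow eq_sym (negPf aa').
  have -> : endpoint x (rcons s a) = target a.
    by rewrite /endpoint map_rcons last_rcons.
  have [Rab|nRab] := boolP (R a b).
    rewrite (R_comp _ _ Rab) eqxx cfu (bigD1 a) //= big1 ?addr0 ?subrr //.
    by move=> a' /andP[_ aa']; rewrite cf_mul_arrow eq_sym (negPf aa').
  rewrite big1 => [|a' Ra'b]; last first.
    rewrite cf_mul_arrow; case: eqP => //= aa'.
    by rewrite aa' Ra'b in nRab.
  rewrite subr0; case: eqP => // ab.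
  have := ub x _ (avoids_rcons2 av nRab).
  rewrite cf_mul_arrow eqxx /=.
  have -> : endpoint x (rcons s a) = target a.
    by rewrite /endpoint map_rcons last_rcons.
  by rewrite ab eqxx.
- exact: R_comp.
- by move=> a b Rab; rewrite arrow_mul_eq0.
- exists N => w wN.
  suff : pi (\prod_(b <- w) arrow_elt k b) = 0 by rewrite rmorph_prod.
  apply/pi_eq0/(order_ge_monomial avN); rewrite -wN.
  elim: w {wN} => [|b w IH]; first by move=> x s.
  rewrite big_cons [size _]/= -add1n.
  apply: order_geM => // y [|//] _.
  by rewrite cf_arrow andbF.
Qed.

(** The witness is A/Ab. If it had projective dimension at most 1, there would
    be z with z b = 0 and a z = a; the former makes the coefficient of z at
    the trivial path zero, the latter makes it one. *)
Lemma monomial_quotient_not_pd_le1 N a b :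
  (forall x s, composable x s -> avoids s -> (size s < N)%N) ->
  R a b -> target a = source b ->
  ~ (forall M : lmodType A,
       fin_dim (quot_scalar monomial_ideal) M -> pd_le 1 M).
Proof.
move=> avN Rab ab pd1.
have [M [g [g_surj kerg]]] := quot_mod_exists (Submodule (im_submod (rmul (ar b)))).
have kergE (r : A) : g r = 0 <-> exists l : A, l * ar b = r.
  by rewrite kerg; split=> [/asboolP|h]; [|apply/asboolP].
have Mfd : fin_dim (quot_scalar monomial_ideal) M.
  apply: fin_dim_surj g_surj _; apply: (fin_dim_quotient (N := N)).
  exact: order_ge_monomial.
have [z [zb zP]] := principal_quotient_pd_le1 g_surj kergE (pd1 M Mfd).
have za := zP _ (arrow_mul_eq0 Rab).
have [u uE] := pi_surj z; move: zb za; rewrite uE -!rmorphM.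
move=> /pi_eq0/(_ (source b) [:: b] isT).
rewrite -[[:: b]]/(rcons [::] b) cf_mul_arrow !eqxx /= => u0.
move=> /quot_eqP/(_ (source a) [:: a] isT).
rewrite cfB cfM big_ord_recl big_ord1 /= !cf_arrow !eqxx /= mul0r add0r mul1r.
rewrite /endpoint /= ab u0 sub0r => /eqP.
by rewrite oppr_eq0 oner_eq0.
Qed.

End QuadraticMonomialQuotient.

(** * Loops *)

Section Loops.
Variables (k : fieldType) (Q : quiver) (I : ideal (path_alg k Q)).
Variables (N : nat) (a : arrow Q).
Hypotheses (NI : order_ge N `<=` I) (I2 : I `<=` order_ge 2).
Hypothesis loop_a : is_loop a.
Local Notation A := (quot_ring I).

Let coef (u : path_alg k Q) : k := cf (source a, [:: a]) u.

Let tau (z : A) : k := coef (repr z).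

Let tau_pi u : tau (quot_pi I u) = coef u.
Proof.
have /I2/(_ (source a) [:: a] isT) := @quot_repr _ I u.
by rewrite cfB => /eqP; rewrite subr_eq0 => /eqP.
Qed.

Let pi_onto (z : A) : exists u, z = quot_pi I u.
Proof. by elim/quot_ind: z => u; exists u. Qed.

Let tau_additive : zmod_morphism tau.
Proof.
move=> y z; have [u ->] := pi_onto y; have [v ->] := pi_onto z.
by rewrite -rmorphB !tau_pi /coef cfB.
Qed.

Let tau_trace (y z : A) : tau (y * z) = tau (z * y).
Proof.
have [u ->] := pi_onto y; have [v ->] := pi_onto z.
rewrite -!rmorphM !tau_pi /coef !cfM !big_ord_recl !big_ord0 /= /endpoint /=.
by rewrite -loop_a !addr0 addrC mulrC [X in _ + X]mulrC.
Qed.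

Let tau_add : {additive A -> k} :=
  HB.pack tau (GRing.isZmodMorphism.Build A k tau tau_additive).

(** The coefficient of the loop a is a trace form with value 1 on a, while a
    is nilpotent in the quotient. *)
Lemma loop_not_pd_le2 :
  ~ (forall M : lmodType A, fin_dim (quot_scalar I) M -> pd_le 2 M).
Proof.
move=> pd2.
have : tau_add (quot_pi I (arrow_elt k a)) = 0.
  apply: (@nilpotent_trace _ _ _ tau_add tau_trace N _ (fin_dim_quotient NI) pd2).
  rewrite -rmorphXn -(raddf0 (quot_pi I)); apply/quot_eqP.
  rewrite subr0; apply: NI; elim: N => [|n IH]; first by move=> x s.
  rewrite exprS -add1n; apply: order_geM => // x [|//] _.
  by rewrite cf_arrow andbF.
rewrite /= tau_pi /coef cf_arrow !eqxx /= => /eqP.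
by rewrite oner_eq0.
Qed.

End Loops.

(** * Peaks of a ranked quiver *)

Section PeakRelations.
Variables (Q : quiver) (rk : vertex Q -> nat) (n : nat).
Hypotheses (rk_inj : injective rk) (rk_le : forall x, (rk x <= n)%N).
Hypothesis no_loop : forall a : arrow Q, ~ is_loop a.

Definition ascending (a : arrow Q) : bool := (rk (source a) < rk (target a))%N.

Definition peak (a b : arrow Q) : bool :=
  [&& target a == source b, ascending a & ~~ ascending b].

Lemma descending (a : arrow Q) :
  ~~ ascending a -> (rk (target a) < rk (source a))%N.
Proof.
rewrite /ascending -leqNgt leq_eqVlt => /orP[/eqP/rk_inj/esym|//].
by move/no_loop.
Qed.

(** After an ascending arrow, a path without peaks only ascends. *)
Lemma ascending_size (a : arrow Q) s :
  ascending a -> composable (target a) s -> avoids peak (a :: s) ->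
  (rk (target a) + size s <= n)%N.
Proof.
elim: s a => [|b s IH] a asc_a /=; first by rewrite addn0.
move=> /andP[/eqP ba bs] /andP[nab avs].
have asc_b : ascending b.
  by move: nab; rewrite /peak ba eqxx asc_a /= negbK.
apply: leq_trans (IH b asc_b bs avs); rewrite addnS -addSn leq_add2r -ba.
exact: asc_b.
Qed.

(** While the path descends the rank of the current vertex bounds what is left
    of the descent; once it turns upwards, [ascending_size] bounds the rest by
    n. *)
Lemma avoids_peak_size x s :
  composable x s -> avoids peak s -> (size s <= rk x + n.+1)%N.
Proof.
elim: s x => [//|a s IH] x /= /andP[/eqP <- cs] avs.
have [asc_a|/descending desc_a] := boolP (ascending a).
  rewrite addnS ltnS; apply: leq_trans (leq_addl _ _).
  by apply: leq_trans (ascending_size asc_a cs avs); exact: leq_addl.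
have /(IH _ cs) le_s : avoids peak s by move: avs; apply: path_sorted.
by apply: leq_ltn_trans le_s _; rewrite ltn_add2r.
Qed.

Lemma avoids_peak_bounded x s :
  composable x s -> avoids peak s -> (size s < n + n.+2)%N.
Proof.
move=> cs avs; rewrite addnS ltnS.
by apply: leq_trans (avoids_peak_size cs avs) _; rewrite leq_add2r.
Qed.

End PeakRelations.

(** * Paths of length two *)

Section PathsOfLengthTwo.
Variables (k : fieldType) (Q : quiver).

Lemma order_ge_composable n (x : vertex Q) s : composable x s -> (n <= size s)%N ->
  order_ge n <> [set 0 : path_alg k Q].
Proof.
move=> cs le_ns on0; pose p := @QPath Q (x, s) cs.
have : order_ge n (path_elt k p).
  move=> y t lt_tn; rewrite cf_path; case: eqP => // -[_ st].
  by move: lt_tn; rewrite -st ltnNge le_ns.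
rewrite on0 => /(congr1 (cf (x, s))); rewrite cf_path eqxx cf0 => /eqP.
by rewrite oner_eq0.
Qed.

Lemma order_ge2_composable : order_ge 2 <> [set 0 : path_alg k Q] ->
  exists a b : arrow Q, target a = source b.
Proof.
move=> nz; apply: contrapT => no_pair; apply: nz; apply/seteqP; split=> u.
  move=> u2; apply: cf_eq0 => x [|a [|b s]]; try exact: u2.
  apply: cf_noncomposable; apply/negP => /= /andP[_ /andP[/eqP ba _]].
  by apply: no_pair; exists a, b.
by move=> -> x s _; exact: cf0.
Qed.

End PathsOfLengthTwo.

Lemma ideal_eq (A : pzRingType) (I J : ideal A) :
  ideal_set I = ideal_set J -> I = J.
Proof.
case: I J => [I I_id] [J J_id] /= IJ; rewrite IJ in I_id *.
by congr Ideal; exact: Prop_irrelevance.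
Qed.

Theorem corollary2 (k : fieldType) (Q : quiver) :
  (exists I : ideal (path_alg k Q),
     admissible I /\ gldim (quot_scalar I) = Some 2%N)
  <->
  (forall a : arrow Q, ~ is_loop a) /\
  ideal_exp (arrow_ideal k Q) 2 <> [set 0].
Proof.
rewrite ideal_exp_arrow_ideal; split.
  move=> [I [[N _]]]; rewrite !ideal_exp_arrow_ideal => -[NI I2].
  move=> /gldim_eqS[pd2 npd1]; split=> [a loop_a|o2].
    exact: (loop_not_pd_le2 NI I2 loop_a).
  (* I vanishes, so it is the monomial ideal of the empty set of relations. *)
  apply: npd1; pose R : rel (arrow Q) := fun _ _ => false.
  have -> : I = monomial_ideal k R.
    have [I0 _ _ _] := idealP I; apply/ideal_eq/seteqP; split=> u.
      by move=> /I2; rewrite o2 => -> x s _; exact: cf0.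
    move=> Ru; suff -> : u = 0 by [].
    apply: cf_eq0 => x s; apply: Ru.
    by case: s => //= a s; elim: s a => //= b s IH a; exact: IH.
  have short x s : composable x s -> avoids R s -> (size s < 2)%N.
    move=> cs _; rewrite ltnNge; apply/negP => le2s.
    exact: (order_ge_composable cs le2s o2).
  have R_comp c d : R c d -> target c = source d by [].
  by apply: (monomial_pd_le1 (monomial_quotient k R_comp short)).
move=> [no_loop /order_ge2_composable[a [b ab]]].
pose n := #|vertex Q|.
(* The middle vertex of ab gets the highest rank, which makes ab a peak. *)
pose rk x : nat := if x == target a then n else enum_rank x.
have rk_le x : (rk x <= n)%N.
  by rewrite /rk; case: ifP => // _; exact/ltnW/ltn_ord.
have rk_inj : injective rk.
  move=> x y; rewrite /rk; case: eqP => [->|_]; case: eqP => [->|_] //.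
  - by move=> ny; have := ltn_ord (enum_rank y); rewrite -ny ltnn.
  - by move=> nx; have := ltn_ord (enum_rank x); rewrite nx ltnn.
  - by move=> /ord_inj/enum_rank_inj.
have rk_top x : x <> target a -> (rk x < rk (target a))%N.
  by rewrite /rk eqxx; case: eqP => // _ _; exact: ltn_ord.
pose R := peak rk.
have R_comp c d : R c d -> target c = source d by case/andP=> /eqP.
have avN := avoids_peak_bounded rk_inj rk_le no_loop.
have qm := monomial_quotient k R_comp avN.
have Rab : R a b.
  rewrite /R /peak ab eqxx /ascending -ab rk_top; last exact: no_loop.
  rewrite -leqNgt ltnW // rk_top // => tb; apply: (no_loop b).
  by rewrite /is_loop tb -ab.
exists (monomial_ideal k R); split.
  exists (n + n.+2)%N; first by rewrite addnS.
  rewrite !ideal_exp_arrow_ideal; split; last exact: monomial_order_ge2.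
  exact: order_ge_monomial.
apply/gldim_eqS; split; last exact: (monomial_quotient_not_pd_le1 avN Rab ab).
apply: (monomial_pd_le2 qm) => c d f /and3P[_ asc_c _].
by rewrite /R /peak asc_c !andbF.
Qed.
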